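(* Let $y:M\to Q^n_r$ be a timelike $(\pm)$-isothermic surface and let $\hat y=[\hat Y]$ be a Darboux transform of $y$. If $\psi$ is a non-degenerate $c$-polar surface of $y$, then there exists a $c$-polar surface $\hat\psi$ of $\hat y$ such that $\hat\psi$ is also a Darboux transform of $\psi$.
   Context: $\mathbb{R}^m_s$ is $\mathbb{R}^m$ with $\langle x,x\rangle=\sum_{i=1}^{m-s}x_i^2-\sum_{i=m-s+1}^m x_i^2$. Let $n-r\ge2$, $r\ge1$. $Q^n_r$ is the set of points $[x]\in\mathbb{R}P^{n+1}$ with $x\in\mathbb{R}^{n+2}_{r+1}\setminus\{0\}$, $\langle x,x\rangle=0$, with the conformal structure induced by $\langle\,,\rangle$. Surfaces in a projective light cone. A lift of $y:M\to Q^n_r$ is a local map $Y$ into nonzero null vectors with $[Y]=y$. $y$ is timelike if $\langle dY,dY\rangle$ is a Lorentzian metric. Asymptotic coordinates $(u,v)$ satisfy $\langle Y_u,Y_u\rangle=\langle Y_v,Y_v\rangle=0$; the canonical lift satisfies $\langle Y_u,Y_v\rangle=\frac12$ (if $\langle Y_u,Y_v\rangle<0$, one passes to $(u,-v)$; the coordinates $(u,v)$ and $(u,-v)$ are not distinguished). Put $V=\mathrm{Span}\{Y,Y_u,Y_v,Y_{uv}\}$, $V^\perp$ its orthogonal complement, $D$ the normal connection on $V^\perp$. The conformal Hopf differentials $\kappa_1,\kappa_2\in\Gamma(V^\perp)$ are defined by $Y_{uu}=-\frac{s_1}{2}Y+\kappa_1$, $Y_{vv}=-\frac{s_2}{2}Y+\kappa_2$.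 $y$ is timelike $(\pm)$-isothermic if around each point there are asymptotic coordinates with $\kappa_1=\pm\kappa_2$ (adapted coordinates). The same definitions apply in the projective light cone of any nondegenerate indefinite inner product space. Darboux transforms. Given a timelike $(\pm)$-isothermic surface $y$ with canonical lift $Y$ with respect to the adapted coordinate $(u,v)$, a timelike immersion $\hat y$ of $M$ into the same projective light cone is a Darboux transform of $y$ if a local lift $\hat Y$ of $\hat y$ satisfies $\langle Y,\hat Y\rangle\neq0$, $\hat Y_u\in\mathrm{Span}\{\hat Y,Y,Y_v\}$ and $\hat Y_v\in\mathrm{Span}\{\hat Y,Y,Y_u\}$ (independent of the choice of lifts). $c$-polar surfaces. A $c$-polar transform (or $c$-polar surface) of $y$ is a section $\psi\in\Gamma(V^\perp)$ with $D_u\psi=D_v\psi=0$ and $\langle\psi,\psi\rangle=c$ constant; for $c\ne0$ it is regarded as a map into $P_c=\{x\in\mathbb{R}^{n+2}_{r+1}:\langle x,x\rangle=c\}$, for $c=0$ as the map $[\psi]$ into $Q^n_r$. It is non-degenerate if it is an immersion, i.e. $\langle\psi,\kappa_1\rangle\ne0$. For $c\ne0$, a surface $x$ in $P_c$ is identified with the surface $[(x,1)]$ in the projective light cone of $\mathbb{R}^{n+2}_{r+1}\oplus\mathbb{R}$ with quadratic form $\langle x,x\rangle-ct^2$, and isothermicity and Darboux transforms are understood for the latter.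
   Formalization: The claim that ψ̂ is a Darboux transform of ψ is made only on the open set where ψ̂ is immersed, which is shown to be exactly where ψ is not orthogonal to ŷ; as literally stated it fails, e.g. when ŷ lies in a hyperplane e^⊥ and its only c-polar surfaces are the constants ±e. *)

(* Defs.v *)
From HB Require Import structures.
From mathcomp Require Import all_boot all_order all_algebra.
From mathcomp Require Import all_classical all_reals all_analysis.
Import Order.TTheory GRing.Theory Num.Theory.
Import numFieldNormedType.Exports.

Set Implicit Arguments.
Unset Strict Implicit.
Unset Printing Implicit Defensive.

Local Open Scope classical_set_scope.
Local Open Scope ring_scope.

(* C^oo maps: all iterated directional derivatives are differentiable. *)

Fixpoint iter_differentiable (R : realType) (E F : normedModType R) (k : nat)
    (U : set E) (f : E -> F) : Prop :=
  (forall x, U x -> differentiable f x) /\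
  (if k is k'.+1 then
     forall a : E, iter_differentiable k' U (fun x => 'D_a f x)
   else True).

Definition smooth (R : realType) (E F : normedModType R)
    (U : set E) (f : E -> F) : Prop :=
  forall k, iter_differentiable k U f.

(* Smooth surfaces, given by a maximal atlas.  A chart is recorded through its
   local parametrization [cpar] of M by an open set [cdom] of the (u,v)-plane,
   together with the inverse [ccoord].  The values of [cpar] outside [cdom], and
   of [ccoord] outside the image of [cdom], are irrelevant. *)

Record chart (R : realType) (M : topologicalType) := Chart {
  cdom : set (R * R);
  cpar : R * R -> M;
  ccoord : M -> R * R;
  cdom_open : open cdom;
  cparK : forall z, cdom z -> ccoord (cpar z) = z;
  cpar_continuous : forall z, cdom z -> {for z, continuous cpar};
  cpar_open : forall A, open A -> A `<=` cdom -> open (cpar @` A)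
}.

Definition smooth_transition (R : realType) (M : topologicalType)
    (k1 k2 : chart R M) : Prop :=
  smooth (cdom k1 `&` cpar k1 @^-1` (cpar k2 @` cdom k2)) (ccoord k2 \o cpar k1).

Definition compatible (R : realType) (M : topologicalType)
    (k1 k2 : chart R M) : Prop :=
  smooth_transition k1 k2 /\ smooth_transition k2 k1.

Record smooth_surface (R : realType) := SmoothSurface {
  carrier :> topologicalType;
  atlas : set (chart R carrier);
  surface_hausdorff : hausdorff_space carrier;
  surface_second_countable : @second_countable carrier;
  atlas_cover : forall p, exists2 k, atlas k & (cpar k @` cdom k) p;
  atlas_compatible : forall k1 k2, atlas k1 -> atlas k2 -> compatible k1 k2;
  atlas_maximal :
    forall k, (forall k', atlas k' -> compatible k k') -> atlas k
}.

Definition chart_at (R : realType) (M : smooth_surface R) (p : M)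
    (k : chart R M) : Prop :=
  atlas k /\ (cpar k @` cdom k) p.

Definition smooth_map (R : realType) (M : smooth_surface R)
    (V : normedModType R) (f : M -> V) : Prop :=
  forall k : chart R M, atlas k -> smooth (cdom k) (f \o cpar k).

Definition du (R : realType) (V : normedModType R) (f : R * R -> V)
    (z : R * R) : V := 'D_((1, 0) : R * R) f z.
Definition dv (R : realType) (V : normedModType R) (f : R * R -> V)
    (z : R * R) : V := 'D_((0, 1) : R * R) f z.

Definition lin_span (R : realType) (V : normedModType R) (s : seq V) : set V :=
  [set x | exists a : nat -> R, x = \sum_(i < size s) a i *: s`_i].

(* The inner product of an inner product space V is a map B : V -> V -> R. *)

Definition orth (R : realType) (V : normedModType R) (B : V -> V -> R)
    (W : set V) : set V :=
  [set x | forall w, W w -> B x w = 0].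

(* The point [x] of the projective space of V is represented by the line R x. *)
Definition proj_pt (R : realType) (V : normedModType R) (x : V) : set V :=
  [set t *: x | t in [set: R]].

Definition proj_light_cone (R : realType) (V : normedModType R)
    (B : V -> V -> R) : set (set V) :=
  [set proj_pt x | x in [set x | x <> 0 /\ B x x = 0]].

Definition pseudo_euclid (R : realType) (m s : nat) (x y : 'rV[R]_m) : R :=
  \sum_(i < m | (i < m - s)%N) x 0 i * y 0 i
  - \sum_(i < m | (m - s <= i)%N) x 0 i * y 0 i.

(* The inner product of R^(n+2)_(r+1), whose projective light cone is Q^n_r. *)
Definition conf_form (R : realType) (n r : nat) : 'rV[R]_n.+2 -> 'rV[R]_n.+2 -> R :=
  @pseudo_euclid R n.+2 r.+1.

Definition Qnr (R : realType) (n r : nat) : set (set 'rV[R]_n.+2) :=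
  proj_light_cone (@conf_form R n r).

(* The polarization of <x,x> - c t^2 on V (+) R. *)
Definition ext_form (R : realType) (V : normedModType R) (B : V -> V -> R)
    (c : R) (x y : V * R^o) : R :=
  B x.1 y.1 - c * x.2 * y.2.

(* Signature (1,1), for a symmetric bilinear form g on the tangent plane. *)
Definition lorentzian (R : realType) (g : R * R -> R * R -> R) : Prop :=
  exists e1 e2, [/\ g e1 e1 = 1, g e2 e2 = -1 & g e1 e2 = 0].

Section LightConeSurfaces.
Variables (R : realType) (V : normedModType R) (B : V -> V -> R).
Variable M : smooth_surface R.
Implicit Types (y yh : M -> set V) (k : chart R M) (Y : R * R -> V).

(* A lift of y over the domain of the coordinates k, expressed in these
   coordinates. *)
Definition lift k y Y : Prop :=
  smooth (cdom k) Y /\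
  forall z, cdom k z ->
    [/\ Y z <> 0, B (Y z) (Y z) = 0 & y (cpar k z) = proj_pt (Y z)].

(* Since <dY,dY> is nondegenerate and <Y,dY> = 0, such a y is an immersion. *)
Definition timelike_on (W : set M) y : Prop :=
  forall p, W p -> exists k, chart_at p k /\ exists Y, lift k y Y /\
    forall z, cdom k z -> lorentzian (fun a b => B ('D_a Y z) ('D_b Y z)).

Definition canonical_lift k y Y : Prop :=
  lift k y Y /\
  forall z, cdom k z ->
    [/\ B (du Y z) (du Y z) = 0, B (dv Y z) (dv Y z) = 0 &
        B (du Y z) (dv Y z) = 2^-1].

(* V = Span{Y, Y_u, Y_v, Y_uv} *)
Definition central Y (z : R * R) : set V :=
  lin_span [:: Y z; du Y z; dv Y z; dv (du Y) z].

Definition normal Y (z : R * R) : set V := orth B (central Y z).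

(* w is the component of x in V^\perp; for x = psi_u this is D_u psi. *)
Definition normal_part Y (z : R * R) (x w : V) : Prop :=
  normal Y z w /\ central Y z (x - w).

Definition hopf Y (z : R * R) (kappa1 kappa2 : V) : Prop :=
  [/\ normal Y z kappa1, normal Y z kappa2,
      exists s1 : R, du (du Y) z = - (s1 / 2) *: Y z + kappa1 &
      exists s2 : R, dv (dv Y) z = - (s2 / 2) *: Y z + kappa2].

(* The coordinates k are adapted, with canonical lift Y; the sign eps is 1 for
   (+)-isothermic and -1 for (-)-isothermic surfaces. *)
Definition adapted (eps : R) k y Y : Prop :=
  canonical_lift k y Y /\
  forall z, cdom k z ->
    exists kappa1 kappa2, hopf Y z kappa1 kappa2 /\ kappa1 = eps *: kappa2.

Definition isothermic_on (eps : R) (W : set M) y : Prop :=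
  timelike_on W y /\
  forall p, W p -> exists k, chart_at p k /\ exists Y, adapted eps k y Y.

(* yh is a Darboux transform of the timelike isothermic surface y.  No separate
   clause is needed for (u,-v): it is again a chart of the maximal atlas, and
   the conditions on the spans do not change under v -> -v. *)
Definition darboux_on (eps : R) (W : set M) y yh : Prop :=
  [/\ isothermic_on eps W y, timelike_on W yh &
  forall p, W p -> exists k, chart_at p k /\ exists Y Yh,
    [/\ adapted eps k y Y, lift k yh Yh &
    forall z, cdom k z ->
      [/\ B (Y z) (Yh z) <> 0,
          lin_span [:: Yh z; Y z; dv Y z] (du Yh z) &
          lin_span [:: Yh z; Y z; du Y z] (dv Yh z)]]].

(* psi is a c-polar surface of the timelike surface y.  For c = 0 the map [psi]
   to the projective light cone has to be defined. *)
Definition c_polar (c : R) y (psi : M -> V) : Prop :=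
  [/\ smooth_map psi,
      forall p, B (psi p) (psi p) = c,
      c = 0 -> forall p, psi p <> 0 &
  forall p, exists k, chart_at p k /\ exists Y,
    canonical_lift k y Y /\
    forall z, cdom k z ->
      [/\ normal Y z (psi (cpar k z)),
          normal_part Y z (du (psi \o cpar k) z) 0 &
          normal_part Y z (dv (psi \o cpar k) z) 0]].

(* The c-polar surface psi, a map to P_c if c <> 0 and the map [psi] if c = 0,
   is immersed at p: the kernel of its differential is trivial. *)
Definition polar_immersed_at (c : R) (psi : M -> V) (p : M) : Prop :=
  forall k z, atlas k -> cdom k z -> cpar k z = p ->
  forall a : R * R,
    (if c == 0 then proj_pt (psi p) else [set 0]) ('D_a (psi \o cpar k) z) ->
    a = 0.

End LightConeSurfaces.

(* psih is, over W, a Darboux transform of psi, both being regarded as surfaces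
   in P_c, identified with surfaces in a projective light cone, if c <> 0, and
   as surfaces in the projective light cone of V if c = 0. *)
Definition polar_darboux_on (R : realType) (V : normedModType R)
    (B : V -> V -> R) (M : smooth_surface R) (eps c : R) (W : set M)
    (psi psih : M -> V) : Prop :=
  (c <> 0 ->
     darboux_on (ext_form B c) eps W
       (fun p => proj_pt ((psi p, 1) : V * R^o))
       (fun p => proj_pt ((psih p, 1) : V * R^o))) /\
  (c = 0 ->
     darboux_on B eps W
       (fun p => proj_pt (psi p)) (fun p => proj_pt (psih p))).

(* Main.v *)
Require Import Defs.
From HB Require Import structures.
From mathcomp Require Import all_boot all_order all_algebra.
From mathcomp Require Import all_classical all_reals all_analysis.
From mathcomp Require Import ring lra.
Import Order.TTheory GRing.Theory Num.Theory.
Import numFieldNormedType.Exports.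
Set Implicit Arguments.
Unset Strict Implicit.
Unset Printing Implicit Defensive.
Local Open Scope classical_set_scope.
Local Open Scope ring_scope.

(** The construction is local, and in one chart it is a computation with inner
products.  Let Y be the canonical lift of y in adapted coordinates (u,v), and
scale the lift Yh of the Darboux transform so that <Y,Yh> = 1.  Put
p = <Yh,Y_u>, q = <Yh,Y_v>, f = <psi,Yh> and mu = - <psi_u,Y_u>, which is
<psi,kappa_1>.  The null conditions, the symmetry of second derivatives and the
isothermic condition give

    psi_u = 2 mu_v Y - 2 mu Y_v,       psi_v = eps (2 mu_u Y - 2 mu Y_u),
    Yh_u = - p Yh - g q Y + g Y_v,     Yh_v = - q Yh - eps g p Y + eps g Y_u

with a constant g ([pd_polar], [pd_partner], [darboux_coeff_sym],
[pd_darboux_coeff]).  Non-degeneracy of psi means mu <> 0, and g <> 0 because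
yh is timelike.  The c-polar surface of yh is

    psih = psi - f Y + rho Yh,         rho = 2 mu / g.

The coefficient - f makes psih orthogonal to Yh; rho is the one coefficient for
which Y_v cancels in psih_u, and it is then also the one for which Y_u cancels
in psih_v.  What remains is psih_u = - f/(eps g) Yh_v + (..) Yh, and
symmetrically in v ([pd_polar_hat_parallel]): psih is parallel for yh, whose
canonical lift is Yh / g, and psih is immersed exactly where f <> 0.

For the Darboux property both values of c are treated together.  Let Psi be psi
if c = 0 and (psi, 1) if c <> 0, so that Psi is null in either case.  The lift
Z = Psi / (2 mu) is canonical in the coordinates (u, eps v), and
Z_uu - eps Z_vv is a multiple of Z ([model_isothermic]), which is the
isothermic condition.  Moreover psih_u - f / (2 eps mu) psi_v is a multiple of
psih - psi ([pd_polar_hat_darboux]), which is the Darboux condition, and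
<Psi,Psih> = rho f.

Two facts make psih a map on the surface.  A change of charts multiplies lifts
by functions and has, in null coordinates, a diagonal or antidiagonal Jacobian;
so everything that is transported between charts is first phrased with first
derivatives only.  For polar surfaces this is [polar_at].  For psih it is the
remark that rho Yh is the only multiple of Yh for which the derivatives of psi
and Yh satisfy psi_a + rho Yh_a in Span(Y, Yh) for every direction a
([polar_hat_change]). *)

(** * Iterated differentiability *)

Section Calculus.
Variable R : realType.
Implicit Types E F G W : normedModType R.

Lemma derive_dirD E F (f : E -> F) x a b :
  differentiable f x -> 'D_(a + b) f x = 'D_a f x + 'D_b f x.
Proof. by move=> df; rewrite !deriveE// linearD. Qed.

Lemma derive_dirZ E F (f : E -> F) x (t : R) a :
  differentiable f x -> 'D_(t *: a) f x = t *: 'D_a f x.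
Proof. by move=> df; rewrite !deriveE// linearZ. Qed.

Lemma derive_comp E F G (g : E -> F) (f : F -> G) x a :
  differentiable g x -> differentiable f (g x) ->
  'D_a (f \o g) x = 'D_('D_a g x) f (g x).
Proof.
move=> dg df; rewrite deriveE; last exact: differentiable_comp.
by rewrite diff_comp//= -!deriveE.
Qed.

(** Differentiability is a local property: this is the case of a map that
vanishes near [x], to which [differentiable_eq_on] reduces by subtraction. *)
Lemma differentiable_vanish E F (h : E -> F) (U : set E) x :
  open U -> U x -> (forall z, U z -> h z = 0) -> differentiable h x.
Proof.
move=> oU Ux h0.
have e : h \o shift x = cst (h x) + (\0 : {linear E -> F}) +o_ 0 id.
  apply/eqaddoP => eps eps0.
  have : \forall y \near (0 : E), U (y + x).
    have := open_nbhs_nbhs (conj oU Ux).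
    rewrite -[nbhs x U]/(\forall z \near x, U z) (near_shift 0) subr0.
    exact.
  apply: filterS => y Uy; rewrite !fctE /= h0// (h0 x)// addr0 subrr normr0.
  by rewrite mulr_ge0// ltW.
have c0 : continuous (\0 : {linear E -> F}) by move=> y; exact: cvg_cst.
apply/diff_locallyP; rewrite (diff_unique c0 e); split => //.
Qed.

Lemma differentiable_eq_on E F (f g : E -> F) (U : set E) x :
  open U -> U x -> (forall z, U z -> f z = g z) ->
  differentiable f x -> differentiable g x.
Proof.
move=> oU Ux fg df; have -> : g = f + (g - f) by rewrite addrC subrK.
apply: differentiableD => //; apply: (differentiable_vanish oU Ux) => z Uz.
by rewrite -[LHS]/(g z - f z) fg// subrr.
Qed.

Lemma derive_eq_on E F (f g : E -> F) (U : set E) x a :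
  open U -> U x -> (forall z, U z -> f z = g z) -> 'D_a f x = 'D_a g x.
Proof.
move=> oU Ux fg; apply: near_eq_derive.
by apply: filterS (open_nbhs_nbhs (conj oU Ux)) => z; exact: fg.
Qed.

(** The Leibniz rule for scalings, products and inner products alike. *)
Lemma derive_bilinear E F G W (b : {bilinear F -> G -> W}) (f : E -> F) (g : E -> G) x :
  continuous (fun p => b p.1 p.2) ->
  differentiable f x -> differentiable g x ->
  differentiable (fun z => b (f z) (g z)) x /\
  forall a, 'D_a (fun z => b (f z) (g z)) x = b ('D_a f x) (g x) + b (f x) ('D_a g x).
Proof.
move=> cb df dg.
have dp : differentiable (fun z => (f z, g z)) x by exact: differentiable_pair.
have db : differentiable (fun p => b p.1 p.2) (f x, g x) by exact: differentiable_bilin.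
have dc : differentiable ((fun p => b p.1 p.2) \o (fun z => (f z, g z))) x.
  exact: differentiable_comp.
split=> // a.
rewrite -[LHS]/('D_a ((fun p => b p.1 p.2) \o (fun z => (f z, g z))) x).
by rewrite deriveE// diff_comp//= diff_bilin//= diff_pair//= !deriveE// addrC.
Qed.

Lemma scaler_is_bilinear F :
  bilinear_for (GRing.Scale.Law.clone _ _ *:%R _) (GRing.Scale.Law.clone _ _ *:%R _)
    (@GRing.scale R F : R -> F -> F).
Proof.
split=> [u'|u] a x y /=.
- by rewrite scalerDl scalerA.
- by rewrite scalerDr !scalerA mulrC.
Qed.
HB.instance Definition _ F := bilinear_isBilinear.Build R R F F _ _ (@GRing.scale R F)
  (@scaler_is_bilinear F).

Lemma derive_scale E F (f : E -> R) (g : E -> F) x :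
  differentiable f x -> differentiable g x ->
  differentiable (fun z => f z *: g z) x /\
  forall a, 'D_a (fun z => f z *: g z) x = 'D_a f x *: g x + f x *: 'D_a g x.
Proof.
move=> df dg.
apply: (@derive_bilinear _ _ _ _ (@GRing.scale R F : {bilinear R -> F -> F})) => //.
exact: scale_continuous.
Qed.

Lemma itd_diff E F k U (f : E -> F) x : iter_differentiable k U f -> U x -> differentiable f x.
Proof. by case: k => [|k] [] + _ => /[apply]. Qed.

Lemma itd_eq_on E F k U (f g : E -> F) : open U -> (forall z, U z -> f z = g z) ->
  iter_differentiable k U f -> iter_differentiable k U g.
Proof.
move=> oU; elim: k f g => [|k IH] f g fg [df Df].
  by split => // x Ux; exact: (differentiable_eq_on oU Ux fg (df x Ux)).
split=> [x Ux|a]; first exact: (differentiable_eq_on oU Ux fg (df x Ux)).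
by apply: IH (Df a) => z Uz; exact: derive_eq_on fg.
Qed.

Lemma itd_sub E F k U U' (f : E -> F) : U' `<=` U ->
  iter_differentiable k U f -> iter_differentiable k U' f.
Proof.
move=> sU; elim: k f => [|k IH] f [df Df].
  by split=> // x /sU /df.
by split=> [x /sU /df //|a]; exact: IH (Df a).
Qed.

(** [iter_differentiable k U f] only speaks of points of [U], one at a time; so
smoothness may be checked in a different chart near each point. *)
Lemma itd_local E F k U (f : E -> F) :
  (forall x, U x -> iter_differentiable k [set x] f) -> iter_differentiable k U f.
Proof.
elim: k f => [|k IH] f Uf.
  by split=> // x Ux; case: (Uf x Ux) => + _; apply.
split=> [x Ux|a]; first by case: (Uf x Ux) => + _; apply.
by apply: IH => x Ux; case: (Uf x Ux) => _; apply.
Qed.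

Lemma itdW E F k U (f : E -> F) : iter_differentiable k.+1 U f -> iter_differentiable k U f.
Proof.
elim: k f => [|k IH] f [df Df]; first by split.
by split=> // a; exact: IH (Df a).
Qed.

Lemma itd_cst E F k U (c : F) : iter_differentiable k U (fun _ : E => c).
Proof.
elim: k c => [|k IH] c; first by split=> // x _; exact: differentiable_cst.
split=> [x _|a]; first exact: differentiable_cst.
have -> : (fun x : E => 'D_a (fun=> c) x) = (fun _ => 0).
  by apply/funext => x; rewrite derive_cst.
exact: IH.
Qed.

Lemma itd_add E F k U (f g : E -> F) : open U ->
  iter_differentiable k U f -> iter_differentiable k U g ->
  iter_differentiable k U (fun z => f z + g z).
Proof.
move=> oU; elim: k f g => [|k IH] f g [df Df] [dg Dg].
  by split=> // x Ux; apply: differentiableD; [exact: df|exact: dg].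
split=> [x Ux|a]; first by apply: differentiableD; [exact: df|exact: dg].
apply: itd_eq_on (IH _ _ (Df a) (Dg a)) => // x Ux.
by rewrite deriveD//; apply: diff_derivable; [exact: df|exact: dg].
Qed.

Lemma itd_bilinear E F G W (b : {bilinear F -> G -> W}) k U (f : E -> F) (g : E -> G) :
  continuous (fun p => b p.1 p.2) -> open U ->
  iter_differentiable k U f -> iter_differentiable k U g ->
  iter_differentiable k U (fun z => b (f z) (g z)).
Proof.
move=> cb oU; elim: k f g => [|k IH] f g Hf Hg.
  split=> // x Ux.
  by case: (derive_bilinear cb (itd_diff Hf Ux) (itd_diff Hg Ux)).
split=> [x Ux|a].
  by case: (derive_bilinear cb (itd_diff Hf Ux) (itd_diff Hg Ux)).
have h1 := IH _ _ (Hf.2 a) (itdW Hg).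
have h2 := IH _ _ (itdW Hf) (Hg.2 a).
apply: itd_eq_on (itd_add oU h1 h2) => // x Ux.
by case: (derive_bilinear cb (itd_diff Hf Ux) (itd_diff Hg Ux)) => _ ->.
Qed.

Lemma itd_scale E F k U (f : E -> R) (g : E -> F) : open U ->
  iter_differentiable k U f -> iter_differentiable k U g ->
  iter_differentiable k U (fun z => f z *: g z).
Proof.
apply: (@itd_bilinear _ _ _ _ (@GRing.scale R F : {bilinear R -> F -> F})).
exact: scale_continuous.
Qed.

Lemma itd_mul E k U (f g : E -> R) : open U ->
  iter_differentiable k U f -> iter_differentiable k U g ->
  iter_differentiable k U (fun z => f z * g z).
Proof. exact: itd_scale. Qed.

(** By induction on [k], since the derivative of 1/f is - f'/f^2, in which 1/f
occurs with one derivative less. *)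
Lemma itd_inv E k U (f : E -> R) : open U -> (forall z, U z -> f z != 0) ->
  iter_differentiable k U f -> iter_differentiable k U (fun z => (f z)^-1).
Proof.
move=> oU f0; elim: k => [|k IH] Hf.
  by split=> // x Ux; apply: differentiableV; [exact: itd_diff Hf Ux|exact: f0].
split=> [x Ux|a].
  by apply: differentiableV; [exact: itd_diff Hf Ux|exact: f0].
have Hi := IH (itdW Hf).
have H := itd_mul oU (itd_mul oU (itd_cst (E:=E) (F:=R) k U (-1 : R)) (itd_mul oU Hi Hi)) (Hf.2 a).
apply: itd_eq_on H => // x Ux.
rewrite deriveV//; [|exact: f0|exact/diff_derivable/(itd_diff Hf Ux)].
by rewrite /= expr2 invfM mulN1r.
Qed.

Lemma derive_linear E F G (J : {linear F -> G}) (f : E -> F) x : continuous J ->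
  differentiable f x -> differentiable (J \o f) x /\ forall a, 'D_a (J \o f) x = J ('D_a f x).
Proof.
move=> cJ df.
have dJ : differentiable J (f x) by exact: linear_differentiable.
have dc : differentiable (J \o f) x by exact: differentiable_comp.
by split=> // a; rewrite !deriveE// diff_comp//= diff_lin.
Qed.

Lemma itd_linear E F G (J : {linear F -> G}) k U (f : E -> F) : continuous J -> open U ->
  iter_differentiable k U f -> iter_differentiable k U (J \o f).
Proof.
move=> cJ oU; elim: k f => [|k IH] f Hf.
  by split=> // x Ux; case: (derive_linear cJ (itd_diff Hf Ux)).
split=> [x Ux|a]; first by case: (derive_linear cJ (itd_diff Hf Ux)).
apply: itd_eq_on (IH _ (Hf.2 a)) => // x Ux.
by case: (derive_linear cJ (itd_diff Hf Ux)) => _ ->.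
Qed.

Lemma derive_plane F (f : R * R -> F) x (a : R * R) : differentiable f x ->
  'D_a f x = a.1 *: du f x + a.2 *: dv f x.
Proof.
move=> df; rewrite /du /dv -!derive_dirZ// -derive_dirD//; congr ('D_ _ f x).
case: a => a1 a2; apply: injective_projections => /=;
  by rewrite /GRing.scale/= ?mulr0 ?mulr1 ?addr0 ?add0r.
Qed.

(** The derivatives of a composite are sums of products of derivatives of [t]
with derivatives of [f] composed with [t], so the induction closes up. *)
Lemma itd_comp E F k U V (t : E -> R * R) (f : R * R -> F) : open U ->
  (forall x, U x -> V (t x)) ->
  iter_differentiable k U t -> iter_differentiable k V f ->
  iter_differentiable k U (f \o t).
Proof.
move=> oU UV; elim: k f => [|k IH] f Ht Hf.
  split=> // x Ux; apply: differentiable_comp; first exact: itd_diff Ht Ux.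
  by apply: itd_diff Hf _; exact: UV.
split=> [x Ux|a].
  by apply: differentiable_comp; [exact: itd_diff Ht Ux|apply: itd_diff Hf _; exact: UV].
have cfst : continuous (fst : R * R -> R) by move=> x; exact: cvg_fst.
have csnd : continuous (snd : R * R -> R) by move=> x; exact: cvg_snd.
have h1 := itd_linear (J:=fst : {linear (R * R)%type -> R}) cfst oU (Ht.2 a).
have h2 := itd_linear (J:=snd : {linear (R * R)%type -> R}) csnd oU (Ht.2 a).
have Hu := IH _ (itdW Ht) (Hf.2 (1, 0)).
have Hv := IH _ (itdW Ht) (Hf.2 (0, 1)).
have H := itd_add oU (itd_scale oU h1 Hu) (itd_scale oU h2 Hv).
apply: itd_eq_on H => // x Ux.
have dt := itd_diff Ht Ux; have df := itd_diff Hf (UV x Ux).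
by rewrite derive_comp ?derive_plane.
Qed.

Lemma is_derive_fst F (f : R * R -> F) s t : differentiable f (s, t) ->
  is_derive s 1 (fun s => f (s, t)) (du f (s, t)).
Proof.
move=> /diff_derivable df.
have e : (fun h : R => h^-1 *: (((fun s => f (s, t)) \o shift s) (h *: 1) - f (s, t))) =
  (fun h : R => h^-1 *: ((f \o shift (s, t)) (h *: (1, 0)) - f (s, t))).
  apply/funext => h /=; congr (_ *: (f _ - _)).
  by apply: injective_projections => //=; rewrite /GRing.scale/= ?mulr0 ?add0r.
apply: DeriveDef; last by rewrite /du /derive e.
by rewrite /derivable e; exact: df.
Qed.

Lemma is_derive_snd F (f : R * R -> F) s t : differentiable f (s, t) ->
  is_derive t 1 (fun t => f (s, t)) (dv f (s, t)).
Proof.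
move=> /diff_derivable df.
have e : (fun h : R => h^-1 *: (((fun t => f (s, t)) \o shift t) (h *: 1) - f (s, t))) =
  (fun h : R => h^-1 *: ((f \o shift (s, t)) (h *: (0, 1)) - f (s, t))).
  apply/funext => h /=; congr (_ *: (f _ - _)).
  by apply: injective_projections => //=; rewrite /GRing.scale/= ?mulr0 ?add0r.
apply: DeriveDef; last by rewrite /dv /derive e.
by rewrite /derivable e; exact: df.
Qed.

Lemma mvt (f df : R -> R) (a h : R) : 0 < h ->
  (forall x : R, a <= x <= a + h -> is_derive x 1 f (df x)) ->
  exists2 c, a <= c <= a + h & f (a + h) - f a = df c * h.
Proof.
move=> h0 Hf; have leah : a <= a + h by rewrite lerDl ltW.
have cf : {within `[a, a + h], continuous f}.
  by apply: derivable_within_continuous => x; rewrite in_itv/= => /Hf [].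
have [x|c ca e] := @MVT_segment R f df a (a + h) leah _ cf.
  by rewrite in_itv/= => /andP[/ltW ? /ltW ?]; apply: Hf; apply/andP.
by exists c; [rewrite in_itv/= in ca|rewrite e; congr (_ * _); ring].
Qed.

End Calculus.

(** * Symmetry of second derivatives *)

Section MixedDerivatives.
Variable R : realType.

(** The algebra of the symmetry of second derivatives: the mean value theorem,
applied twice in either order to the increment of a function over a square,
yields a value of each of the two mixed derivatives. *)
Lemma double_increment (a b c d p q A B h : R) : h != 0 ->
  a - b - (c - d) = p * h -> p = A * h ->
  a - c - (b - d) = q * h -> q = B * h -> A = B.
Proof.
move=> h0 p1 p2 p3 p4; apply: (mulIf h0); apply: (mulIf h0).
by rewrite -p2 -p4 -p1 -p3; ring.
Qed.

Lemma dist_le_split (A B C e : R) :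
  `|A - C| < e / 2 -> `|B - C| < e / 2 -> `|A - B| <= e.
Proof.
move=> AC BC; rewrite -(subrKA C) (splitr e) (le_trans (ler_normD _ _))//.
by rewrite lerD ?ltW// distrC.
Qed.

Lemma mixed_derivatives (f : R * R -> R) (U : set (R * R)) z : open U -> U z ->
  iter_differentiable 2 U f -> dv (du f) z = du (dv f) z.
Proof.
move=> oU Uz Hf; apply/eqP; rewrite -subr_eq0 -normr_le0; apply/ler_addgt0Pr => e e0.
rewrite add0r.
have cA : {for z, continuous (dv (du f))}.
  by apply: differentiable_continuous; case: (Hf.2 (1, 0)) => _ /(_ (0, 1))[+ _]; apply.
have cB : {for z, continuous (du (dv f))}.
  by apply: differentiable_continuous; case: (Hf.2 (0, 1)) => _ /(_ (1, 0))[+ _]; apply.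
have e2 : 0 < e / 2 by rewrite divr_gt0.
have nA : \forall w \near z, `|dv (du f) z - dv (du f) w| < e / 2.
  by have /cvgrPdist_lt := cA; apply.
have nB : \forall w \near z, `|du (dv f) z - du (dv f) w| < e / 2.
  by have /cvgrPdist_lt := cB; apply.
have nU : \forall w \near z, U w by apply: open_nbhs_nbhs.
have : \forall w \near z, (`|dv (du f) z - dv (du f) w| < e / 2 /\
    `|du (dv f) z - du (dv f) w| < e / 2) /\ U w.
  exact: filterI (filterI nA nB) nU.
move=> /nbhs_ballP [d /= d0 Hd].
case: z Uz cA cB nA nB nU Hd => x y Uz _ _ _ _ _ Hd.
(* The square of side d/2 at z lies in the ball of radius d. *)
pose h := d / 2.
have h0 : 0 < h by rewrite divr_gt0.
have Hb s t : x <= s <= x + h -> y <= t <= y + h -> ball (x, y) d (s, t).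
  move=> /andP[s1 s2] /andP[t1 t2]; have hd : h < d by rewrite ltr_pdivrMr// ltr_pMr// ltr1n.
  by split; rewrite -ball_normE /ball_/= ler0_norm; lra.
have HU s t : x <= s <= x + h -> y <= t <= y + h -> U (s, t).
  by move=> sx ty; case: (Hd _ (Hb _ _ sx ty)).
have xx : x <= x <= x + h by rewrite lexx lerDl ltW.
have yy : y <= y <= y + h by rewrite lexx lerDl ltW.
have xh : x <= x + h <= x + h by rewrite lexx lerDl ltW.
have yh : y <= y + h <= y + h by rewrite lexx lerDl ltW.
have df w : U w -> differentiable f w by move=> Uw; exact: itd_diff Hf Uw.
have ddu w : U w -> differentiable (du f) w.
  by move=> Uw; apply: (itd_diff (k:=1) (U:=U) (f:=du f)) => //; exact: Hf.2.
have ddv w : U w -> differentiable (dv f) w.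
  by move=> Uw; apply: (itd_diff (k:=1) (U:=U) (f:=dv f)) => //; exact: Hf.2.
have [s1 s1P e1] := @mvt R (fun s => f (s, y + h) - f (s, y))
  (fun s => du f (s, y + h) - du f (s, y)) x h h0
  (fun s sP => is_deriveB (is_derive_fst (df _ (HU _ _ sP yh))) (is_derive_fst (df _ (HU _ _ sP yy)))).
have [t1 t1P e1'] := @mvt R (fun t => du f (s1, t)) (fun t => dv (du f) (s1, t)) y h h0
  (fun t tP => is_derive_snd (ddu _ (HU _ _ s1P tP))).
have [t2 t2P e2'] := @mvt R (fun t => f (x + h, t) - f (x, t))
  (fun t => dv f (x + h, t) - dv f (x, t)) y h h0
  (fun t tP => is_deriveB (is_derive_snd (df _ (HU _ _ xh tP))) (is_derive_snd (df _ (HU _ _ xx tP)))).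
have [s2 s2P e2''] := @mvt R (fun s => dv f (s, t2)) (fun s => du (dv f) (s, t2)) x h h0
  (fun s sP => is_derive_fst (ddv _ (HU _ _ sP t2P))).
have E : dv (du f) (s1, t1) = du (dv f) (s2, t2).
  by apply: (double_increment _ e1 e1' e2' e2''); rewrite gt_eqF.
have [[a1 _] _] := Hd _ (Hb _ _ s1P t1P).
have [[_ a2] _] := Hd _ (Hb _ _ s2P t2P).
by rewrite -E in a2; exact: dist_le_split a1 a2.
Qed.
End MixedDerivatives.

(** * Smooth maps *)

Section Smooth.
Variable R : realType.
Implicit Types E F G : normedModType R.

Lemma smooth_diff E F U (f : E -> F) x : smooth U f -> U x -> differentiable f x.
Proof. by move=> sf Ux; exact: itd_diff (sf 0%N) Ux. Qed.

Lemma smooth_derive E F U (f : E -> F) a : smooth U f -> smooth U (fun x => 'D_a f x).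
Proof. by move=> sf k; case: (sf k.+1) => _; apply. Qed.

Lemma smooth_du F U (f : R * R -> F) : smooth U f -> smooth U (du f).
Proof. exact: smooth_derive. Qed.

Lemma smooth_dv F U (f : R * R -> F) : smooth U f -> smooth U (dv f).
Proof. exact: smooth_derive. Qed.

Lemma smooth_sub E F U U' (f : E -> F) : U' `<=` U -> smooth U f -> smooth U' f.
Proof. by move=> sU sf k; exact: itd_sub (sf k). Qed.

Lemma smooth_eq_on E F U (f g : E -> F) : open U -> (forall z, U z -> f z = g z) ->
  smooth U f -> smooth U g.
Proof. by move=> oU fg sf k; exact: itd_eq_on (sf k). Qed.

Lemma smooth_local E F U (f : E -> F) :
  (forall x, U x -> exists2 N, N x & smooth N f) -> smooth U f.
Proof.
move=> Uf k; apply: itd_local => x /Uf[N Nx sf].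
by apply: itd_sub (sf k) => _ ->.
Qed.

Lemma smooth_cst E F U (c : F) : smooth U (fun _ : E => c).
Proof. by move=> k; exact: itd_cst. Qed.

Lemma smoothD E F U (f g : E -> F) : open U ->
  smooth U f -> smooth U g -> smooth U (fun z => f z + g z).
Proof. by move=> oU sf sg k; exact: itd_add. Qed.

Lemma smoothZ E F U (f : E -> R) (g : E -> F) : open U ->
  smooth U f -> smooth U g -> smooth U (fun z => f z *: g z).
Proof. by move=> oU sf sg k; exact: itd_scale. Qed.

Lemma smoothM E U (f g : E -> R) : open U ->
  smooth U f -> smooth U g -> smooth U (fun z => f z * g z).
Proof. by move=> oU sf sg k; exact: itd_mul. Qed.

Lemma smoothN E F U (f : E -> F) : open U -> smooth U f -> smooth U (fun z => - f z).
Proof.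
move=> oU sf; apply: (smooth_eq_on oU) (smoothZ oU (smooth_cst U (-1 : R)) sf) => z _.
by rewrite scaleN1r.
Qed.

Lemma smoothV E U (f : E -> R) : open U -> (forall z, U z -> f z != 0) ->
  smooth U f -> smooth U (fun z => (f z)^-1).
Proof. by move=> oU f0 sf k; exact: itd_inv. Qed.

Lemma smooth_linear E F G (J : {linear F -> G}) U (f : E -> F) : continuous J -> open U ->
  smooth U f -> smooth U (J \o f).
Proof. by move=> cJ oU sf k; exact: itd_linear. Qed.

Lemma smooth_comp E F U V (t : E -> R * R) (f : R * R -> F) : open U ->
  (forall x, U x -> V (t x)) -> smooth U t -> smooth V f -> smooth U (f \o t).
Proof. by move=> oU UV st sf k; exact: itd_comp UV (st k) (sf k). Qed.

Lemma derive_add E F (f g : E -> F) x a : differentiable f x -> differentiable g x ->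
  'D_a (fun z => f z + g z) x = 'D_a f x + 'D_a g x.
Proof. by move=> df dg; rewrite -deriveD//; exact: diff_derivable. Qed.
End Smooth.

(** * Inner product spaces *)

Section InnerProduct.
Variables (R : realType) (V : normedModType R) (B : V -> V -> R).

Record inner_product : Prop := InnerProduct {
  ip_sym : forall x y, B x y = B y x;
  ip_linear : forall y (a : R) x x', B (a *: x + x') y = a * B x y + B x' y;
  ip_continuous : continuous (fun p : V * V => B p.1 p.2);
  ip_nondegenerate : forall x, (forall y, B x y = 0) -> x = 0
}.

Hypothesis hB : inner_product.

Lemma ipDl x x' y : B (x + x') y = B x y + B x' y.
Proof. by rewrite -[x]scale1r ip_linear// mul1r scale1r. Qed.
Lemma ip0l y : B 0 y = 0.
Proof. by apply: (addrI (B 0 y)); rewrite -ipDl !addr0. Qed.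
Lemma ipZl a x y : B (a *: x) y = a * B x y.
Proof. by rewrite -[_ *: _]addr0 ip_linear// ip0l addr0. Qed.
Lemma ipNl x y : B (- x) y = - B x y.
Proof. by rewrite -scaleN1r ipZl mulN1r. Qed.
Lemma ipDr x y y' : B x (y + y') = B x y + B x y'.
Proof. by rewrite !(ip_sym hB x) ipDl. Qed.
Lemma ip0r x : B x 0 = 0. Proof. by rewrite ip_sym// ip0l. Qed.
Lemma ipZr a x y : B x (a *: y) = a * B x y.
Proof. by rewrite !(ip_sym hB x) ipZl. Qed.
Lemma ipNr x y : B x (- y) = - B x y.
Proof. by rewrite !(ip_sym hB x) ipNl. Qed.

Lemma ip_is_bilinear :
  bilinear_for (GRing.Scale.Law.clone _ _ *:%R _) (GRing.Scale.Law.clone _ _ *:%R _)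
    (B : V -> V -> R).
Proof.
by split=> [u'|u] a x y /=; rewrite ?(ipDl, ipDr) ?(ipZl, ipZr).
Qed.

Lemma derive_ip (E : normedModType R) (f g : E -> V) x :
  differentiable f x -> differentiable g x ->
  differentiable (fun z => B (f z) (g z)) x /\
  forall a, 'D_a (fun z => B (f z) (g z)) x = B ('D_a f x) (g x) + B (f x) ('D_a g x).
Proof.
pose b : {bilinear V -> V -> R} :=
  HB.pack B (bilinear_isBilinear.Build R V V R _ _ B ip_is_bilinear).
exact: (@derive_bilinear R E V V R b f g x (ip_continuous hB)).
Qed.

Lemma smooth_ip (E : normedModType R) U (f g : E -> V) : open U ->
  smooth U f -> smooth U g -> smooth U (fun z => B (f z) (g z)).
Proof.
pose b : {bilinear V -> V -> R} :=
  HB.pack B (bilinear_isBilinear.Build R V V R _ _ B ip_is_bilinear).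
move=> oU sf sg k.
exact: (@itd_bilinear R E V V R b k U f g (ip_continuous hB) oU (sf k) (sg k)).
Qed.

Lemma derive_ip_eq (E : normedModType R) U (f g : E -> V) (h : E -> R) a x :
  open U -> smooth U f -> smooth U g ->
  (forall z, U z -> B (f z) (g z) = h z) -> U x ->
  B ('D_a f x) (g x) + B (f x) ('D_a g x) = 'D_a h x.
Proof.
move=> oU sf sg fg Ux.
have <- := (derive_ip (smooth_diff sf Ux) (smooth_diff sg Ux)).2 a.
exact: derive_eq_on oU Ux fg.
Qed.

(** The scalar case applied to the functions <f, w>; nondegeneracy recovers the
equality of vectors. *)
Lemma dvduC U (f : R * R -> V) z : open U -> smooth U f -> U z -> du (dv f) z = dv (du f) z.
Proof.
move=> oU sf Uz; apply/eqP; rewrite -subr_eq0; apply/eqP; apply: (ip_nondegenerate hB) => w.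
pose g z := B (f z) w.
have sg : smooth U g by apply: smooth_ip => //; exact: smooth_cst.
have D a (h : R * R -> V) x : smooth U h -> U x ->
    'D_a (fun z => B (h z) w) x = B ('D_a h x) w.
  move=> sh Ux; have := (derive_ip (smooth_diff sh Ux) (differentiable_cst w x)).2 a.
  by rewrite [in X in _ = X]derive_cst ip0r addr0.
have e1 : dv (du g) z = B (dv (du f) z) w.
  apply: etrans (D (0, 1) (du f) z (smooth_du sf) Uz).
  by apply: derive_eq_on oU Uz _ => x Ux; exact: D.
have e2 : du (dv g) z = B (du (dv f) z) w.
  apply: etrans (D (1, 0) (dv f) z (smooth_dv sf) Uz).
  by apply: derive_eq_on oU Uz _ => x Ux; exact: D.
have e : B (du (dv f) z) w = B (dv (du f) z) w.
  exact: etrans (esym e2) (etrans (esym (mixed_derivatives oU Uz (sg 2))) e1).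
by rewrite ipDl ipNl; apply/eqP; rewrite subr_eq0; apply/eqP.
Qed.
End InnerProduct.

Section Span.
Variables (R : realType) (V : normedModType R).
Implicit Types x y w : V.

Lemma lin_span3 x y t w : lin_span [:: x; y; t] w <->
  exists a b d : R, w = a *: x + b *: y + d *: t.
Proof.
split=> [[a ->]|[a [b [d ->]]]].
  by exists (a 0%N), (a 1%N), (a 2%N); rewrite !big_ord_recl big_ord0 addr0 addrA.
by exists (nth 0 [:: a; b; d]); rewrite !big_ord_recl big_ord0 /= addr0 addrA.
Qed.

Lemma lin_span4 x y t s w : lin_span [:: x; y; t; s] w <->
  exists a b d e : R, w = a *: x + b *: y + d *: t + e *: s.
Proof.
split=> [[a ->]|[a [b [d [e ->]]]]].
  by exists (a 0%N), (a 1%N), (a 2%N), (a 3%N); rewrite !big_ord_recl big_ord0 addr0 !addrA.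
by exists (nth 0 [:: a; b; d; e]); rewrite !big_ord_recl big_ord0 /= addr0 !addrA.
Qed.
End Span.

(** * Directional derivatives of maps of the plane *)

(** Directions are kept as variables: every formula below is proved for the
derivative in a direction [a] and read again with [a] and [b] exchanged, and the
direction (0, -1) accounts for the coordinates (u, -v).  The definition is
sealed because unification should not compare limits. *)
HB.lock Definition pd (R : realType) (F : normedModType R) (a : R * R) (f : R * R -> F)
  (z : R * R) : F := 'D_a f z.

Section Partial.
Variable R : realType.
Implicit Types (F : normedModType R) (U : set (R * R)) (a b : R * R).

Lemma pdE F a (f : R * R -> F) : pd a f = (fun z => 'D_a f z).
Proof. by apply/funext => z; rewrite pd.unlock. Qed.

Lemma smooth_pd F U a (f : R * R -> F) : smooth U f -> smooth U (pd a f).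
Proof. by rewrite pdE; exact: smooth_derive. Qed.

Lemma pd_eq_on F U a (f g : R * R -> F) z : open U -> (forall x, U x -> f x = g x) ->
  U z -> pd a f z = pd a g z.
Proof. by move=> oU fg Uz; rewrite !pdE; exact: derive_eq_on oU Uz fg. Qed.

Lemma pd_cst F a (c : F) z : pd a (fun _ => c) z = 0.
Proof. by rewrite pdE derive_cst. Qed.

Lemma pd_add F U a (f g : R * R -> F) z : smooth U f -> smooth U g -> U z ->
  pd a (fun x => f x + g x) z = pd a f z + pd a g z.
Proof. by move=> sf sg Uz; rewrite !pdE derive_add//; exact: smooth_diff Uz. Qed.

Lemma pd_scale F U a (f : R * R -> R) (g : R * R -> F) z : smooth U f -> smooth U g -> U z ->
  pd a (fun x => f x *: g x) z = pd a f z *: g z + f z *: pd a g z.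
Proof.
move=> sf sg Uz; rewrite !pdE.
exact: (derive_scale (smooth_diff sf Uz) (smooth_diff sg Uz)).2.
Qed.

Lemma pd_mul U a (f g : R * R -> R) z : smooth U f -> smooth U g -> U z ->
  pd a (fun x => f x * g x) z = pd a f z * g z + f z * pd a g z.
Proof. exact: pd_scale. Qed.

Lemma pd_opp F U a (f : R * R -> F) z : smooth U f -> U z ->
  pd a (fun x => - f x) z = - pd a f z.
Proof.
move=> sf Uz; rewrite !pdE; apply: deriveN.
by apply: diff_derivable; exact: smooth_diff Uz.
Qed.

Lemma pd_dirZ F U (t : R) a (f : R * R -> F) z : smooth U f -> U z ->
  pd (t *: a) f z = t *: pd a f z.
Proof. by move=> sf Uz; rewrite !pdE derive_dirZ//; exact: smooth_diff Uz. Qed.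

Lemma duE F (f : R * R -> F) : du f = pd (1, 0) f. Proof. by rewrite pdE. Qed.
Lemma dvE F (f : R * R -> F) : dv f = pd (0, 1) f. Proof. by rewrite pdE. Qed.

Lemma pd_plane F U a (f : R * R -> F) z : smooth U f -> U z ->
  pd a f z = a.1 *: pd (1, 0) f z + a.2 *: pd (0, 1) f z.
Proof.
by move=> sf Uz; rewrite -duE -dvE pdE derive_plane//; exact: smooth_diff Uz.
Qed.
End Partial.

Section PartialIP.
Variables (R : realType) (V : normedModType R) (B : V -> V -> R).
Hypothesis hB : inner_product B.
Variables (U : set (R * R)) (oU : open U).
Implicit Types (a b : R * R) (f g : R * R -> V).

Lemma pd_ip a f g z : smooth U f -> smooth U g -> U z ->
  pd a (fun x => B (f x) (g x)) z = B (pd a f z) (g z) + B (f z) (pd a g z).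
Proof.
move=> sf sg Uz; rewrite !pdE.
exact: (derive_ip hB (smooth_diff sf Uz) (smooth_diff sg Uz)).2.
Qed.

Lemma pd_ip_cst a f g (k : R) z : smooth U f -> smooth U g ->
  (forall x, U x -> B (f x) (g x) = k) -> U z ->
  B (pd a f z) (g z) + B (f z) (pd a g z) = 0.
Proof.
move=> sf sg fg Uz; rewrite -(pd_ip a sf sg Uz) -(pd_cst a k z).
exact: pd_eq_on oU fg Uz.
Qed.

Lemma pdC a b f z : smooth U f -> U z -> pd a (pd b f) z = pd b (pd a f) z.
Proof.
have expand d e x : smooth U f -> U x -> pd d (pd e f) x =
    e.1 *: (d.1 *: pd (1, 0) (pd (1, 0) f) x + d.2 *: pd (0, 1) (pd (1, 0) f) x) +
    e.2 *: (d.1 *: pd (1, 0) (pd (0, 1) f) x + d.2 *: pd (0, 1) (pd (0, 1) f) x).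
  move=> sf Ux; have sc := smooth_cst U (_ : R).
  rewrite (pd_eq_on d oU (fun x Ux => pd_plane e sf Ux) Ux).
  have s1 t o := smoothZ oU (sc t) (smooth_pd o sf).
  rewrite (pd_add d (s1 _ _) (s1 _ _) Ux).
  rewrite !(pd_scale d (sc _) (smooth_pd _ sf) Ux) !pd_cst !scale0r !add0r.
  by rewrite !(pd_plane d (smooth_pd _ sf) Ux).
move=> sf Uz; rewrite (expand a b)// (expand b a)//.
have e : pd (1, 0) (pd (0, 1) f) z = pd (0, 1) (pd (1, 0) f) z.
  by have := dvduC hB oU sf Uz; rewrite !duE !dvE.
rewrite e.
move: (pd (1, 0) (pd (1, 0) f) z) (pd (0, 1) (pd (1, 0) f) z) (pd (0, 1) (pd (0, 1) f) z) => p q r.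
rewrite !scalerDr !scalerA !(mulrC b.1) !(mulrC b.2).
by rewrite addrACA.
Qed.
End PartialIP.

(** * Null frames, polar sections and Darboux partners *)

Section Core.
Variables (R : realType) (V : normedModType R) (B : V -> V -> R).
Hypothesis hB : inner_product B.
Variables (U : set (R * R)) (oU : open U) (eps : R).
Hypothesis eps2 : eps * eps = 1.
Implicit Types (a b : R * R) (Y Yh psi : R * R -> V).

Let ipE := (ipDl hB, ipDr hB, ipNl hB, ipNr hB, ipZl hB, ipZr hB).

(** [Y] is the canonical lift of a timelike surface, [a] and [b] being the null
directions. *)
Record null_frame a b Y : Prop := NullFrame {
  nf_smooth : smooth U Y;
  nf_00 : forall z, U z -> B (Y z) (Y z) = 0;
  nf_aa : forall z, U z -> B (pd a Y z) (pd a Y z) = 0;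
  nf_bb : forall z, U z -> B (pd b Y z) (pd b Y z) = 0;
  nf_ab : forall z, U z -> B (pd a Y z) (pd b Y z) = 2^-1
}.

Lemma null_frame_sym a b Y : null_frame a b Y -> null_frame b a Y.
Proof. by case=> s y0 ya yb yab; split=> // z Uz; rewrite (ip_sym hB) yab. Qed.

Section Frame.
Variables (a b : R * R) (Y : R * R -> V).
Hypothesis hY : null_frame a b Y.
Let sY := nf_smooth hY.

Lemma null_cst_self k f d z : smooth U f -> (forall x, U x -> B (f x) (f x) = k) -> U z ->
  B (f z) (pd d f z) = 0.
Proof.
move=> sf ff Uz; have := pd_ip_cst hB oU d sf sf ff Uz.
by rewrite (ip_sym hB (pd d f z)) => e; lra.
Qed.

Lemma nf_0d d z : U z -> B (Y z) (pd d Y z) = 0.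
Proof. exact: null_cst_self sY (nf_00 hY). Qed.

Lemma nf_a_da d z : U z -> B (pd a Y z) (pd d (pd a Y) z) = 0.
Proof. exact: null_cst_self (smooth_pd a sY) (nf_aa hY). Qed.

Lemma nf_0ba z : U z -> B (Y z) (pd b (pd a Y) z) = - 2^-1.
Proof.
move=> Uz; have := pd_ip_cst hB oU b sY (smooth_pd a sY) (fun x Ux => nf_0d a Ux) Uz.
by rewrite (ip_sym hB) (nf_ab hY Uz) => e; lra.
Qed.

Lemma nf_0aa z : U z -> B (Y z) (pd a (pd a Y) z) = 0.
Proof.
move=> Uz; have := pd_ip_cst hB oU a sY (smooth_pd a sY) (fun x Ux => nf_0d a Ux) Uz.
by rewrite (nf_aa hY Uz) => e; lra.
Qed.

Lemma nf_b_aa z : U z -> B (pd b Y z) (pd a (pd a Y) z) = 0.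
Proof.
move=> Uz; have := pd_ip_cst hB oU a (smooth_pd a sY) (smooth_pd b sY) (nf_ab hY) Uz.
by rewrite (pdC hB oU a b sY Uz) nf_a_da// (ip_sym hB) => e; lra.
Qed.
End Frame.

(** The first-order form of a parallel normal section: [ps_da] and [ps_db] say
that the derivatives of [psi] lie in the central space, as membership there
reduces to these two spans.  [ps_iso] is what the isothermic condition
kappa_1 = eps kappa_2 says about [psi]. *)
Record polar_section a b Y psi : Prop := PolarSection {
  ps_smooth : smooth U psi;
  ps_0 : forall z, U z -> B (psi z) (Y z) = 0;
  ps_a : forall z, U z -> B (psi z) (pd a Y z) = 0;
  ps_b : forall z, U z -> B (psi z) (pd b Y z) = 0;
  ps_da : forall z, U z -> exists x y : R, pd a psi z = x *: Y z + y *: pd b Y z;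
  ps_db : forall z, U z -> exists x y : R, pd b psi z = x *: Y z + y *: pd a Y z;
  ps_iso : forall z, U z ->
    B (psi z) (pd b (pd b Y) z) = eps * B (psi z) (pd a (pd a Y) z)
}.

Lemma polar_section_sym a b Y psi : polar_section a b Y psi -> polar_section b a Y psi.
Proof.
case=> s y0 ya yb da db iso; split=> // z Uz.
by rewrite iso// mulrA eps2 mul1r.
Qed.

(** The component <psi, kappa> of [psi] along the Hopf differential of the
direction [a], see [hopf_heightE]. *)
Definition hopf_height a Y psi z : R := - B (pd a psi z) (pd a Y z).

Lemma smooth_hopf_height a Y psi : smooth U Y -> smooth U psi ->
  smooth U (hopf_height a Y psi).
Proof.
by move=> sY sp; apply: smoothN => //; apply: smooth_ip => //; exact: smooth_pd.
Qed.

Section Polar.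
Variables (a b : R * R) (Y psi : R * R -> V).
Hypotheses (hY : null_frame a b Y) (hp : polar_section a b Y psi).
Let sY := nf_smooth hY.
Let sp := ps_smooth hp.
Local Notation mu := (hopf_height a Y psi).

Lemma hopf_heightE z : U z -> mu z = B (psi z) (pd a (pd a Y) z).
Proof.
move=> Uz; have := pd_ip_cst hB oU a sp (smooth_pd a sY) (ps_a hp) Uz.
by rewrite /hopf_height => e; lra.
Qed.

Lemma ps_bd_a z : U z -> B (pd b psi z) (pd a Y z) = 0.
Proof.
move=> Uz; have [x [y ->]] := ps_db hp Uz.
by rewrite !ipE (nf_0d hY)// (nf_aa hY)// !mulr0 addr0.
Qed.

(** The coefficient of [pd b Y] is read off by pairing with [pd a Y].  That of [Y]
comes from symmetry of second derivatives: <psi_a, Y_a> = - mu is differentiated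
along [b], and <psi_b, Y_a> = 0 along [a]. *)
Lemma pd_polar z : U z ->
  pd a psi z = (2 * pd b mu z) *: Y z - (2 * mu z) *: pd b Y z.
Proof.
move=> Uz; have [x [y e]] := ps_da hp Uz.
have ey : y = - (2 * mu z).
  rewrite /hopf_height e !ipE (nf_0d hY)// (ip_sym hB (pd b Y z)) (nf_ab hY)//.
  by field.
suff ex : x = 2 * pd b mu z by rewrite e ey ex scaleNr.
have sB := smooth_ip hB oU (smooth_pd a sp) (smooth_pd a sY).
have dmu : pd b mu z =
    - (B (pd b (pd a psi) z) (pd a Y z) + B (pd a psi z) (pd b (pd a Y) z)).
  by rewrite -(pd_ip hB b (smooth_pd a sp) (smooth_pd a sY) Uz) -(pd_opp b sB Uz).
have := pd_ip_cst hB oU a (smooth_pd b sp) (smooth_pd a sY) ps_bd_a Uz.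
rewrite (pdC hB oU a b sp Uz) => e1.
have e2 : B (pd b psi z) (pd a (pd a Y) z) = 0.
  have [x' [y' ->]] := ps_db hp Uz.
  by rewrite !ipE (nf_0aa hY)// (nf_a_da hY)// !mulr0 addr0.
have e3 : B (pd a psi z) (pd b (pd a Y) z) = - x / 2.
  rewrite e !ipE (nf_0ba hY)// -(pdC hB oU a b sY)//.
  by rewrite (nf_a_da (null_frame_sym hY))//; lra.
by lra.
Qed.
End Polar.

Lemma hopf_height_sym a b Y psi z : null_frame a b Y -> polar_section a b Y psi -> U z ->
  hopf_height b Y psi z = eps * hopf_height a Y psi z.
Proof.
move=> hY hp Uz.
rewrite (hopf_heightE hY hp)// (hopf_heightE (null_frame_sym hY) (polar_section_sym hp))//.
exact: ps_iso hp _ Uz.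
Qed.

(** The lift of a Darboux transform, normalized by <Y, Yh> = 1.  With this choice
the coefficients in [pd_partner] are constant. *)
Record darboux_partner a b Y Yh : Prop := DarbouxPartner {
  dp_smooth : smooth U Yh;
  dp_hh : forall z, U z -> B (Yh z) (Yh z) = 0;
  dp_0h : forall z, U z -> B (Y z) (Yh z) = 1;
  dp_da : forall z, U z -> exists x y t : R,
    pd a Yh z = x *: Yh z + y *: Y z + t *: pd b Y z;
  dp_db : forall z, U z -> exists x y t : R,
    pd b Yh z = x *: Yh z + y *: Y z + t *: pd a Y z
}.

Lemma darboux_partner_sym a b Y Yh : darboux_partner a b Y Yh -> darboux_partner b a Y Yh.
Proof. by case. Qed.

(** The coefficient of [pd b Y] in [pd a Yh], see [pd_partner]. *)
Definition darboux_coeff a Y Yh z : R :=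
  2 * (B (pd a Yh z) (pd a Y z) + B (Yh z) (pd a Y z) ^+ 2).

Lemma smooth_darboux_coeff a Y Yh : smooth U Y -> smooth U Yh ->
  smooth U (darboux_coeff a Y Yh).
Proof.
move=> sY sYh; apply: smoothM => //; first exact: smooth_cst.
have sa := smooth_pd a sY.
by apply: smoothD => //; [|apply: smoothM => //]; apply: smooth_ip => //; exact: smooth_pd.
Qed.

Section Partner.
Variables (a b : R * R) (Y Yh : R * R -> V).
Hypotheses (hY : null_frame a b Y) (hd : darboux_partner a b Y Yh).
Let sY := nf_smooth hY.
Let sYh := dp_smooth hd.
Local Notation pY d z := (B (Yh z) (pd d Y z)).
Local Notation g := (darboux_coeff a Y Yh).
Local Notation g' := (darboux_coeff b Y Yh).

Lemma pd_partner z : U z ->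
  pd a Yh z = - pY a z *: Yh z - (g z * pY b z) *: Y z + g z *: pd b Y z.
Proof.
move=> Uz; have [x [y [t e]]] := dp_da hd Uz.
have e0 : x = - pY a z.
  have := pd_ip_cst hB oU a sY sYh (dp_0h hd) Uz.
  rewrite e !ipE (dp_0h hd)// (nf_00 hY)// (nf_0d hY)// (ip_sym hB).
  by move=> h; lra.
have e1 : y = - (t * pY b z).
  have := null_cst_self a sYh (dp_hh hd) Uz.
  rewrite e !ipE (dp_hh hd)// (ip_sym hB (Yh z)) (dp_0h hd)// => h; lra.
have e2 : t = g z.
  rewrite /darboux_coeff e !ipE (nf_0d hY)// (ip_sym hB (pd b Y z)) (nf_ab hY)//.
  by rewrite e0; field.
by rewrite e e0 e1 e2 (scaleNr (g z * _)).
Qed.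

Lemma pd_partner_norm z : U z -> B (pd a Yh z) (pd a Yh z) = 0.
Proof.
move=> Uz; rewrite pd_partner// !ipE (dp_hh hd)// (nf_00 hY)// (nf_bb hY)//.
rewrite (nf_0d hY)// !(ip_sym hB (pd b Y z)) (nf_0d hY)//.
by rewrite (ip_sym hB (Yh z) (Y z)) (dp_0h hd)//; ring.
Qed.

Lemma ip_pd_partner x z : U z ->
  B x (pd a Yh z) = - pY a z * B x (Yh z) - g z * pY b z * B x (Y z) + g z * B x (pd b Y z).
Proof. by move=> Uz; rewrite pd_partner// !ipE. Qed.

End Partner.

Section PartnerConstant.
Variables (a b : R * R) (Y Yh : R * R -> V).
Hypotheses (hY : null_frame a b Y) (hd : darboux_partner a b Y Yh).
Let sY := nf_smooth hY.
Let sYh := dp_smooth hd.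
Let hY' := null_frame_sym hY.
Let hd' := darboux_partner_sym hd.

Lemma pd_partner_cross z : U z ->
  B (pd a Yh z) (pd b Yh z) = darboux_coeff a Y Yh z * darboux_coeff b Y Yh z / 2.
Proof.
move=> Uz; rewrite (ip_pd_partner hY' hd')// !(ip_sym hB (pd a Yh z)) !(ip_pd_partner hY hd)//.
rewrite (dp_hh hd)// (dp_0h hd)// (ip_sym hB (Yh z) (Y z)) (dp_0h hd)//.
rewrite (nf_00 hY)// (nf_0d hY)// !(ip_sym hB (pd a Y z)) (nf_0d hY)// (ip_sym hB (pd b Y z)) (nf_ab hY)//.
by field.
Qed.

(** Both sides of Yh_ab = Yh_ba are paired with [pd b Y]; all terms but the
derivative of the coefficient cancel. *)
Lemma pd_darboux_coeff z : U z -> pd a (darboux_coeff b Y Yh) z = 0.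
Proof.
move=> Uz.
pose p z := B (Yh z) (pd a Y z); pose q z := B (Yh z) (pd b Y z).
pose g' := darboux_coeff b Y Yh.
have sa := smooth_pd a sY; have sb := smooth_pd b sY.
have sp : smooth U p by exact: smooth_ip.
have sq : smooth U q by exact: smooth_ip.
have sg' : smooth U g' by exact: smooth_darboux_coeff.
have sc k := @smooth_cst R (R * R)%type R U k.
(* G1 and G2 are to be differentiated along b and a; G3 gives the derivatives of p and q. *)
have G1 x : U x -> B (pd a Yh x) (pd b Y x) = -1 * (p x * q x).
  move=> Ux; rewrite (ip_sym hB) (ip_pd_partner hY hd)// (ip_sym hB _ (Yh x)).
  rewrite (ip_sym hB _ (Y x)) (nf_0d hY)// (nf_bb hY)// -/(p x) -/(q x); ring.
have G2 x : U x -> B (pd b Yh x) (pd b Y x) = -1 * (q x * q x) + 2^-1 * g' x.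
  move=> Ux; rewrite (ip_sym hB) (ip_pd_partner hY' hd')// (ip_sym hB _ (Yh x)).
  rewrite (ip_sym hB _ (Y x)) (nf_0d hY)// (ip_sym hB (pd b Y x)) (nf_ab hY)// -/(p x) -/(q x) -/(g' x); ring.
have G3 x : U x -> B (pd b Yh x) (pd a Y x) = - (q x * p x).
  move=> Ux; rewrite (ip_sym hB) (ip_pd_partner hY' hd')// (ip_sym hB _ (Yh x)).
  rewrite (ip_sym hB _ (Y x)) (nf_0d hY)// (nf_aa hY)// -/(p x) -/(q x) -/(g' x); ring.
have := derive_ip_eq hB b oU (smooth_pd a sYh) sb G1 Uz.
have := derive_ip_eq hB a oU (smooth_pd b sYh) sb G2 Uz.
(* Back from limits to sealed derivatives. *)
rewrite -!(fun d (F : normedModType R) (f : R * R -> F) => congr1 (@^~ z) (pdE d f)) /=.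
rewrite (pdC hB oU b a sYh Uz).
rewrite (pd_mul b (sc (-1)) (smoothM oU sp sq) Uz) (pd_mul b sp sq Uz) pd_cst mul0r add0r.
rewrite (pd_add a (smoothM oU (sc (-1)) (smoothM oU sq sq)) (smoothM oU (sc 2^-1) sg') Uz).
rewrite (pd_mul a (sc (-1)) (smoothM oU sq sq) Uz) (pd_mul a sq sq Uz) (pd_mul a (sc 2^-1) sg' Uz).
rewrite !pd_cst !mul0r !add0r.
rewrite (pd_ip hB a sYh sb Uz) (pd_ip hB b sYh sa Uz) (pd_ip hB b sYh sb Uz).
rewrite G1// G2// G3//.
rewrite (ip_sym hB (pd b Yh z)) (ip_sym hB (pd a Yh z)).
rewrite (ip_pd_partner hY hd)// (ip_pd_partner hY' hd')//.
rewrite !(ip_sym hB _ (Yh z)) !(ip_sym hB _ (Y z)) (nf_0aa hY')// (nf_0ba hY')//.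
rewrite (pdC hB oU a b sY Uz) (ip_sym hB (pd b (pd b Y) z)) (nf_a_da hY')//.
rewrite (ip_sym hB (pd b (pd a Y) z)) (nf_a_da hY)//.
rewrite -/(p z) -/(q z) -/(g' z).
move: (pd a g' z) => dG; move: (B (pd a (pd b Yh) z) (pd b Y z)) => m1.
move: (B (Yh z) (pd b (pd a Y) z)) => m2; move: (B (Yh z) (pd b (pd b Y) z)) => m3.
by move: (p z) (q z) (g' z) => P Q G e1 e2; lra.
Qed.
End PartnerConstant.

Section HatSection.
Variables (a b : R * R) (Y Yh psi : R * R -> V).
Hypotheses (hY : null_frame a b Y) (hd : darboux_partner a b Y Yh).
Hypothesis hp : polar_section a b Y psi.
Let sY := nf_smooth hY.
Let sYh := dp_smooth hd.
Let sp := ps_smooth hp.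

(** The projection of [psi] along [Y] to the orthogonal complement of [Yh]. *)
Definition partner_proj z : V := psi z - B (psi z) (Yh z) *: Y z.
Local Notation X := partner_proj.

Lemma smooth_partner_proj : smooth U X.
Proof.
apply: smoothD => //; apply: smoothN => //; apply: smoothZ => //.
exact: smooth_ip.
Qed.

Lemma partner_proj_h z : U z -> B (X z) (Yh z) = 0.
Proof. by move=> Uz; rewrite /X !ipE (dp_0h hd)//; ring. Qed.

Lemma partner_proj_0 z : U z -> B (X z) (Y z) = 0.
Proof. by move=> Uz; rewrite /X !ipE (nf_00 hY)// (ps_0 hp)//; ring. Qed.

Lemma partner_proj_d d z : U z -> B (psi z) (pd d Y z) = 0 -> B (X z) (pd d Y z) = 0.
Proof. by move=> Uz e; rewrite /X !ipE (nf_0d hY)// e; ring. Qed.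

Lemma pd_partner_proj d z : U z -> pd d X z =
  pd d psi z - (pd d (fun x => B (psi x) (Yh x)) z *: Y z + B (psi z) (Yh z) *: pd d Y z).
Proof.
move=> Uz; have sf := smooth_ip hB oU sp sYh.
have sfY := smoothZ oU sf sY.
rewrite -(pd_scale d sf sY Uz) -(pd_opp d sfY Uz).
exact: pd_add sp (smoothN oU sfY) Uz.
Qed.
End HatSection.

Section HatSymmetry.
Variables (a b : R * R) (Y Yh psi : R * R -> V).
Hypotheses (hY : null_frame a b Y) (hd : darboux_partner a b Y Yh).
Hypothesis hp : polar_section a b Y psi.
Let sY := nf_smooth hY.
Let sYh := dp_smooth hd.
Let sp := ps_smooth hp.
Let X := partner_proj Y Yh psi.

Lemma partner_proj_hd z : U z -> B (X z) (pd a Yh z) = 0.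
Proof.
move=> Uz; rewrite (ip_pd_partner hY hd)// (partner_proj_h _ hd)// (partner_proj_0 _ hY hp)//.
by rewrite (partner_proj_d _ hY)// ?(ps_b hp)//; ring.
Qed.

Lemma pd_partner_proj_cross z : U z -> 
  B (pd a X z) (pd b Yh z) = - darboux_coeff b Y Yh z * hopf_height a Y psi z.
Proof.
move=> Uz; rewrite (ip_pd_partner (null_frame_sym hY) (darboux_partner_sym hd))//.
have -> : B (pd a X z) (Yh z) = 0.
  have sX : smooth U X by exact: smooth_partner_proj hY hd hp.
  have := pd_ip_cst hB oU a sX sYh (partner_proj_h psi hd) Uz.
  by rewrite partner_proj_hd// addr0.
rewrite (pd_partner_proj hY hd hp)// !ipE.
have e0 : B (pd a psi z) (Y z) = 0.
  have := pd_ip_cst hB oU a sp sY (ps_0 hp) Uz.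
  by rewrite (ps_a hp)// addr0.
rewrite e0 (nf_00 hY)// (ip_sym hB (pd a Y z) (Y z)) (nf_0d hY)// (nf_aa hY)//.
by rewrite /hopf_height; ring.
Qed.
End HatSymmetry.

(** With X the section [partner_proj], the equation <X, Yh_ab> = <X, Yh_ba>
becomes <X_b, Yh_a> = <X_a, Yh_b>, as X is orthogonal to Yh_a and Yh_b.  The two
sides are products of a coefficient of [Yh] with a Hopf height of [psi], and the
two Hopf heights differ by the factor [eps]. *)
Lemma darboux_coeff_sym a b Y Yh psi z :
  null_frame a b Y -> darboux_partner a b Y Yh -> polar_section a b Y psi -> U z ->
  hopf_height a Y psi z != 0 ->
  darboux_coeff b Y Yh z = eps * darboux_coeff a Y Yh z.
Proof.
move=> hY hd hp Uz mu0; apply: (mulIf mu0).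
have hY' := null_frame_sym hY; have hd' := darboux_partner_sym hd.
have hp' := polar_section_sym hp.
have sX : smooth U (partner_proj Y Yh psi) by exact: smooth_partner_proj hY hd hp.
have := pd_ip_cst hB oU b sX (smooth_pd a (dp_smooth hd)) (partner_proj_hd hY hd hp) Uz.
have := pd_ip_cst hB oU a sX (smooth_pd b (dp_smooth hd)) (partner_proj_hd hY' hd' hp') Uz.
rewrite (pd_partner_proj_cross hY hd hp)// (pd_partner_proj_cross hY' hd' hp')//.
rewrite (pdC hB oU a b (dp_smooth hd))// (hopf_height_sym hY hp)//.
by move=> e1 e2; lra.
Qed.
End Core.

(** * The polar surface of the Darboux transform, in a chart *)

(** Equalities of linear combinations of vectors become ring identities after
pairing with an arbitrary vector. *)
Lemma ip_ext (R : realType) (V : normedModType R) (B : V -> V -> R) x y :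
  inner_product B -> (forall w, B x w = B y w) -> x = y.
Proof.
move=> hB e; apply/eqP; rewrite -subr_eq0; apply/eqP/(ip_nondegenerate hB) => w.
by rewrite (ipDl hB) (ipNl hB) e subrr.
Qed.

Lemma mul_inner_product (R : realType) : inner_product (fun x y : R => x * y).
Proof.
split=> [x y|y a x x'||x x0]; first exact: mulrC.
- by rewrite mulrDl mulrA.
- exact: mul_continuous.
- by rewrite -[x]mulr1 x0.
Qed.

Section PolarHat.
Variables (R : realType) (V : normedModType R) (B : V -> V -> R).
Hypothesis hB : inner_product B.
Variables (U : set (R * R)) (oU : open U) (eps : R).
Hypothesis eps2 : eps * eps = 1.

Let ipE := (ipDl hB, ipDr hB, ipNl hB, ipNr hB, ipZl hB, ipZr hB).
Implicit Types (a b : R * R) (Y Yh psi : R * R -> V).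

(** A polar surface together with a Darboux transform, in one chart.  [pp_hopf]
is the non-degeneracy of the polar surface; [pp_coeff] says that the transform
is timelike. *)
Record polar_pair a b Y Yh psi : Prop := PolarPair {
  pp_frame : null_frame B U a b Y;
  pp_partner : darboux_partner B U a b Y Yh;
  pp_polar : polar_section B U eps a b Y psi;
  pp_hopf : forall z, U z -> hopf_height B a Y psi z != 0;
  pp_coeff : forall z, U z -> darboux_coeff B a Y Yh z != 0
}.

Lemma eps_neq0 : eps != 0.
Proof. by apply: contra_eq_neq eps2 => ->; rewrite mul0r eq_sym oner_neq0. Qed.

Lemma polar_pair_coeff a b Y Yh psi z : polar_pair a b Y Yh psi -> U z ->
  darboux_coeff B b Y Yh z = eps * darboux_coeff B a Y Yh z.
Proof.
case=> hY hd hp m0 _ Uz; exact: (darboux_coeff_sym hB oU eps2 hY hd hp Uz (m0 z Uz)).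
Qed.

Lemma polar_pair_hopf a b Y Yh psi z : polar_pair a b Y Yh psi -> U z ->
  hopf_height B b Y psi z = eps * hopf_height B a Y psi z.
Proof.
case=> hY hd hp m0 _ Uz; exact: (hopf_height_sym hB oU eps2 hY hp).
Qed.

Lemma polar_pair_sym a b Y Yh psi : polar_pair a b Y Yh psi -> polar_pair b a Y Yh psi.
Proof.
move=> P; have [hY hd hp m0 g0] := P; split.
- exact: null_frame_sym hB _ _ _ _ hY.
- exact: darboux_partner_sym hd.
- exact: polar_section_sym eps2 _ _ _ _ hp.
- by move=> z Uz; rewrite (polar_pair_hopf P)// mulf_neq0 ?eps_neq0 ?m0.
- by move=> z Uz; rewrite (polar_pair_coeff P)// mulf_neq0 ?eps_neq0 ?g0.
Qed.

(** The coefficient that makes [pd b Y] cancel in [pd_polar_hat]; by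
[hat_height_sym] it is the same for both directions. *)
Definition hat_height a Y Yh psi z : R :=
  2 * hopf_height B a Y psi z / darboux_coeff B a Y Yh z.

Definition polar_hat a Y Yh psi z : V :=
  partner_proj B Y Yh psi z + hat_height a Y Yh psi z *: Yh z.

Section Local.
Variables (a b : R * R) (Y Yh psi : R * R -> V).
Hypothesis P : polar_pair a b Y Yh psi.
Let hY := pp_frame P.
Let hd := pp_partner P.
Let hp := pp_polar P.
Let sY := nf_smooth hY.
Let sYh := dp_smooth hd.
Let sp := ps_smooth hp.
Local Notation mu := (hopf_height B a Y psi).
Local Notation g := (darboux_coeff B a Y Yh).
Local Notation rho := (hat_height a Y Yh psi).
Local Notation f z := (B (psi z) (Yh z)).
Local Notation p z := (B (Yh z) (pd a Y z)).
Local Notation q z := (B (Yh z) (pd b Y z)).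

Lemma hat_height_sym z : U z -> hat_height b Y Yh psi z = rho z.
Proof.
move=> Uz; rewrite /hat_height (polar_pair_hopf P Uz) (polar_pair_coeff P Uz).
by have := eps_neq0; have := pp_coeff P Uz => g0 e0; field; rewrite g0 e0.
Qed.

Lemma polar_hat_sym z : U z -> polar_hat b Y Yh psi z = polar_hat a Y Yh psi z.
Proof. by move=> Uz; rewrite /polar_hat hat_height_sym. Qed.

Lemma hat_heightE z : U z -> rho z * g z = 2 * mu z.
Proof. by move=> Uz; rewrite /hat_height divfK// (pp_coeff P). Qed.

Lemma hat_height_neq0 z : U z -> rho z != 0.
Proof.
by move=> Uz; rewrite /hat_height !mulf_neq0 ?invr_neq0 ?(pp_coeff P) ?(pp_hopf P)// pnatr_eq0.
Qed.

Lemma smooth_pair_hopf : smooth U mu. Proof. exact: smooth_hopf_height. Qed.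

Lemma smooth_hat_height : smooth U rho.
Proof.
apply: smoothM => //; first by apply: smoothM; [|exact: smooth_cst|exact: smooth_pair_hopf].
by apply: smoothV; [|exact: pp_coeff P|exact: smooth_darboux_coeff].
Qed.

Lemma smooth_polar_hat : smooth U (polar_hat a Y Yh psi).
Proof.
apply: smoothD => //.
  exact: (smooth_partner_proj hB oU hY hd hp).
by apply: smoothZ => //; exact: smooth_hat_height.
Qed.

Lemma pd_darboux_coeff_self z : U z -> pd a g z = 0.
Proof.
move=> Uz; have := pd_darboux_coeff hB oU hY hd Uz.
rewrite (pd_eq_on a oU (fun x Ux => polar_pair_coeff P Ux) Uz).
have sg : smooth U g by exact: smooth_darboux_coeff.
rewrite (pd_mul a (@smooth_cst R (R * R)%type R U eps) sg Uz) pd_cst mul0r add0r.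
by move=> /eqP; rewrite mulf_eq0 (negPf eps_neq0) => /eqP.
Qed.

Lemma pd_hat_height z : U z -> mu z * pd a rho z = pd a mu z * rho z.
Proof.
move=> Uz; have sg : smooth U g by exact: smooth_darboux_coeff.
have := pd_eq_on a oU hat_heightE Uz.
rewrite (pd_mul a smooth_hat_height sg Uz) pd_darboux_coeff_self// mulr0 addr0.
rewrite (pd_mul a (@smooth_cst R (R * R)%type R U 2) smooth_pair_hopf Uz) pd_cst mul0r add0r.
have := hat_heightE Uz; have g0 := pp_coeff P Uz => e1 e2.
apply: (mulIf g0); transitivity (mu z * (pd a rho z * g z)); first by ring.
rewrite e2; transitivity (pd a mu z * (rho z * g z)); last by ring.
by rewrite e1; ring.
Qed.

(** No term in [pd b Y] is left: its coefficient is - 2 mu + rho g = 0. *)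
Lemma pd_polar_hat z : U z -> pd a (polar_hat a Y Yh psi) z =
  - f z *: pd a Y z + (f z * p z) *: Y z + (pd a rho z - rho z * p z) *: Yh z.
Proof.
move=> Uz; have sX := smooth_partner_proj hB oU hY hd hp.
rewrite (pd_add a sX (smoothZ oU smooth_hat_height sYh) Uz).
rewrite (pd_scale a smooth_hat_height sYh Uz) (pd_partner_proj hB oU hY hd hp a Uz).
rewrite (pd_ip hB a sp sYh Uz) (pd_partner hB oU hY hd Uz) (pd_polar hB oU hY hp Uz).
apply: (ip_ext hB) => w; rewrite !ipE (dp_0h hd)// !(ip_sym hB (pd b Y z) (Yh z)).
rewrite (ps_0 hp)// (ps_b hp)//.
have e := hat_heightE Uz.
move: (f z) (p z) (q z) (pd a rho z) (pd b mu z) => F P' Q dr dm.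
move: (B _ w) (B _ w) (B _ w) (B _ w) => w1 w2 w3 w4.
have -> : mu z = rho z * g z / 2 by rewrite e; field.
by field.
Qed.

Lemma polar_hat_h z : U z -> B (polar_hat a Y Yh psi z) (Yh z) = 0.
Proof.
move=> Uz; rewrite (ipDl hB) (ipZl hB) (dp_hh hd)// (partner_proj_h hB psi hd)//.
by rewrite mulr0 addr0.
Qed.

Lemma polar_hat_hd z : U z -> B (polar_hat a Y Yh psi z) (pd a Yh z) = 0.
Proof.
move=> Uz; rewrite (ipDl hB) (ipZl hB) (partner_proj_hd hB oU hY hd hp)//.
by rewrite (null_cst_self hB oU a sYh (dp_hh hd) Uz) mulr0 addr0.
Qed.

Lemma polar_hat_norm z : U z ->
  B (polar_hat a Y Yh psi z) (polar_hat a Y Yh psi z) = B (psi z) (psi z).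
Proof.
move=> Uz; rewrite [LHS](ipDr hB) (ipZr hB) polar_hat_h// mulr0 addr0.
rewrite /polar_hat (ipDl hB) (ipZl hB) !(ip_sym hB (Yh z)) (partner_proj_h hB psi hd)// mulr0 addr0.
rewrite [LHS](ipDr hB) (ipNr hB) (ipZr hB) (partner_proj_0 hB Yh hY hp)//.
rewrite /partner_proj (ipDl hB) (ipNl hB) (ipZl hB) (ip_sym hB (Y z)) (ps_0 hp)//; ring.
Qed.

Lemma polar_hat_0 z : U z -> B (polar_hat a Y Yh psi z) (Y z) = rho z.
Proof.
move=> Uz; rewrite (ipDl hB) (ipZl hB) (partner_proj_0 hB Yh hY hp)// (ip_sym hB (Yh z)) (dp_0h hd)//.
by rewrite mulr1 add0r.
Qed.

Lemma polar_hat_psi z : U z -> B (psi z) (polar_hat a Y Yh psi z) = B (psi z) (psi z) + rho z * f z.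
Proof. by move=> Uz; rewrite !ipE (ps_0 hp)//; ring. Qed.

(** The derivative is orthogonal to [Yh], and among the combinations of [Y],
[pd a Y] and [Yh] this leaves only those of [pd b Yh] and [Yh]. *)
Lemma pd_polar_hat_parallel z : U z -> exists t : R, pd a (polar_hat a Y Yh psi) z =
  (- f z / darboux_coeff B b Y Yh z) *: pd b Yh z + t *: Yh z.
Proof.
move=> Uz; exists (pd a rho z - rho z * p z - f z * q z / darboux_coeff B b Y Yh z).
rewrite pd_polar_hat//.
rewrite (pd_partner hB oU (null_frame_sym hB hY) (darboux_partner_sym hd) Uz).
have g0 : darboux_coeff B b Y Yh z != 0 by have := pp_coeff (polar_pair_sym P) Uz.
by apply: (ip_ext hB) => w; rewrite !ipE; field.
Qed.
End Local.
End PolarHat.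

(** * Polar surfaces as surfaces in a light cone *)

Section Model.
Variables (R : realType) (V : normedModType R) (B : V -> V -> R).
Hypothesis hB : inner_product B.
Variables (V' : normedModType R) (B' : V' -> V' -> R).
Hypothesis hB' : inner_product B'.
Variables (J : {linear V -> V'}) (e0 : V') (c : R).
Hypothesis cJ : continuous J.
Hypothesis JJ : forall x y, B' (J x) (J y) = B x y.
Hypothesis Je : forall x, B' (J x) e0 = 0.
Hypothesis ee : B' e0 e0 = - c.
Variables (U : set (R * R)) (oU : open U) (eps : R).
Hypothesis eps2 : eps * eps = 1.

Let ipE := (ipDl hB, ipDr hB, ipNl hB, ipNr hB, ipZl hB, ipZr hB).
Let ipE' := (ipDl hB', ipDr hB', ipNl hB', ipNr hB', ipZl hB', ipZr hB').
Implicit Types (a b : R * R) (Y Yh psi : R * R -> V).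

(** The point of the light cone that represents [x]: with [J x = (x, 0)] and
[e0 = (0, 1)] for c <> 0, and with [J = id] and [e0 = 0] for c = 0. *)
Definition model_point (x : V) : V' := J x + e0.

Lemma model_ip x y : B' (model_point x) (model_point y) = B x y - c.
Proof. by rewrite /model_point !ipE' JJ Je (ip_sym hB' e0) Je ee; ring. Qed.

Lemma model_ipJ x y : B' (model_point x) (J y) = B x y.
Proof. by rewrite /model_point !ipE' JJ (ip_sym hB' e0) Je addr0. Qed.

Lemma smooth_J (F : R * R -> V) : smooth U F -> smooth U (fun z => J (F z)).
Proof. exact: smooth_linear cJ oU. Qed.

Lemma pd_J a (F : R * R -> V) z : smooth U F -> U z -> pd a (fun x => J (F x)) z = J (pd a F z).
Proof. by move=> sF Uz; rewrite !pdE; exact: (derive_linear cJ (smooth_diff sF Uz)).2. Qed.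

Lemma smooth_model (F : R * R -> V) : smooth U F -> smooth U (fun z => model_point (F z)).
Proof. by move=> sF; apply: smoothD => //; [exact: smooth_J|exact: smooth_cst]. Qed.

Lemma pd_model a (F : R * R -> V) z : smooth U F -> U z ->
  pd a (fun x => model_point (F x)) z = J (pd a F z).
Proof.
move=> sF Uz; rewrite (pd_add a (smooth_J sF) (@smooth_cst R (R * R)%type V' U e0) Uz).
by rewrite pd_cst addr0 pd_J.
Qed.

Section Frame.
Variables (a b : R * R) (Y Yh psi : R * R -> V).
Hypothesis P : polar_pair B U eps a b Y Yh psi.
Hypothesis psi_c : forall z, U z -> B (psi z) (psi z) = c.
Let hY := pp_frame P.
Let hd := pp_partner P.
Let hp := pp_polar P.
Let sY := nf_smooth hY.
Let sp := ps_smooth hp.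
Local Notation mu := (hopf_height B a Y psi).
Local Notation Psi := (fun z => model_point (psi z)).

Definition model_scale a Y psi z : R := (2 * hopf_height B a Y psi z)^-1.
Definition model_lift a Y psi z : V' := model_scale a Y psi z *: model_point (psi z).
Local Notation N := (model_scale a Y psi).
Local Notation Z := (model_lift a Y psi).

Lemma scale_mu z : U z -> 2 * mu z * N z = 1.
Proof. by move=> Uz; rewrite mulfV// mulf_neq0 ?pnatr_eq0// (pp_hopf P). Qed.

Lemma model_scale_neq0 z : U z -> N z != 0.
Proof. by move=> Uz; rewrite invr_neq0// mulf_neq0 ?pnatr_eq0// (pp_hopf P). Qed.

Lemma smooth_model_scale : smooth U N.
Proof.
apply: smoothV => //; last by apply: smoothM => //; [exact: smooth_cst|exact: (smooth_pair_hopf hB oU P)].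
by move=> z Uz; rewrite mulf_neq0 ?pnatr_eq0// (pp_hopf P).
Qed.

Lemma smooth_model_lift : smooth U Z.
Proof. by apply: smoothZ => //; [exact: smooth_model_scale|exact: smooth_model]. Qed.

Lemma pd_model_scale d z : U z -> pd d N z = - 2 * N z * N z * pd d mu z.
Proof.
move=> Uz; have := pd_eq_on d oU scale_mu Uz.
have sc := @smooth_cst R (R * R)%type R U 2.
rewrite pd_cst (pd_mul d (smoothM oU sc (smooth_pair_hopf hB oU P)) smooth_model_scale Uz).
rewrite (pd_mul d sc (smooth_pair_hopf hB oU P) Uz) pd_cst mul0r add0r => e.
have := scale_mu Uz.
move: (N z) (mu z) (pd d mu z) (pd d N z) e => n m dm dn e e1.
have -> : dn = n * (2 * m * dn) by rewrite -[LHS](mul1r dn) -{1}e1; ring.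
by rewrite (_ : 2 * m * dn = - (2 * dm * n)); [ring|lra].
Qed.

Lemma pd_model_lift d z : U z -> pd d Z z = pd d N z *: Psi z + N z *: J (pd d psi z).
Proof.
by move=> Uz; rewrite (pd_scale d smooth_model_scale (smooth_model sp) Uz) pd_model.
Qed.

Lemma psi_dpsi d z : U z -> B (psi z) (pd d psi z) = 0.
Proof. exact: (null_cst_self hB oU d sp psi_c). Qed.

Lemma model_lift_null z : U z -> B' (Z z) (Z z) = 0.
Proof. by move=> Uz; rewrite (ipZl hB') (ipZr hB') model_ip psi_c//; ring. Qed.

Lemma model_lift_dd d d' z : U z ->
  B' (pd d Z z) (pd d' Z z) = N z * N z * B (pd d psi z) (pd d' psi z).
Proof.
move=> Uz; rewrite !pd_model_lift// !(ipDl hB', ipDr hB') !(ipZl hB', ipZr hB').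
rewrite model_ip (ip_sym hB' (J _)) !model_ipJ !psi_dpsi//.
by rewrite psi_c// JJ; ring.
Qed.

Lemma dpsi_null z : U z -> B (pd a psi z) (pd a psi z) = 0.
Proof.
move=> Uz; rewrite (pd_polar hB oU hY hp Uz) !ipE (nf_00 hY)// (nf_bb hY)//.
by rewrite (ip_sym hB (pd b Y z)) (nf_0d hB oU hY)//; ring.
Qed.

Lemma dpsi_cross z : U z ->
  B (pd a psi z) (pd b psi z) = 2 * mu z * hopf_height B b Y psi z.
Proof.
move=> Uz; rewrite (pd_polar hB oU hY hp Uz).
rewrite (pd_polar hB oU (null_frame_sym hB hY) (polar_section_sym eps2 hp) Uz).
rewrite !ipE (nf_00 hY)// !(ip_sym hB (pd b Y z)) (nf_ab hY)// !(nf_0d hB oU hY)//.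
by field.
Qed.

(** The terms other than the first are, up to the exchange of [a] and [b],
symmetric once 2 mu N = 1 is used; this is what [model_isothermic] exploits. *)
Lemma pd_pd_model_lift z : U z -> pd a (pd a Z) z = pd a (pd a N) z *: Psi z
  + (4 * pd a N z * pd b mu z + 2 * N z * pd a (pd b mu) z) *: J (Y z)
  - (2 * mu z * pd a N z) *: J (pd b Y z)
  + (2 * N z * pd b mu z) *: J (pd a Y z) - J (pd b (pd a Y) z).
Proof.
move=> Uz; have sc k := @smooth_cst R (R * R)%type R U k.
have sN := smooth_model_scale; have sm := (smooth_pair_hopf hB oU P).
have sPsi := smooth_model sp; have sb := smooth_pd b sY.
have sL := smoothM oU (smoothM oU (sc 2) sN) (smooth_pd b sm).
have s1 := smoothZ oU (smooth_pd a sN) sPsi.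
have s2 := smoothZ oU sL (smooth_J sY).
have s3 := smoothZ oU (sc (-1)) (smooth_J sb).
have e x : U x -> pd a Z x = pd a N x *: Psi x +
    ((2 * N x * pd b mu x) *: J (Y x) + (-1) *: J (pd b Y x)).
  move=> Ux; rewrite pd_model_lift// (pd_polar hB oU hY hp Ux) linearB !linearZ/=.
  rewrite ?scalerN scalerBr !scalerA (_ : N x * (2 * mu x) = 1); last by rewrite mulrC scale_mu.
  by rewrite scale1r scaleN1r; congr (_ + (_ *: _ - _)); ring.
rewrite (pd_eq_on a oU e Uz) (pd_add a s1 (smoothD oU s2 s3) Uz) (pd_add a s2 s3 Uz).
rewrite (pd_scale a (smooth_pd a sN) sPsi Uz) (pd_scale a sL (smooth_J sY) Uz).
rewrite (pd_scale a (sc _) (smooth_J sb) Uz) pd_cst scale0r add0r.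
rewrite pd_model// !pd_J// (pd_mul a (smoothM oU (sc 2) sN) (smooth_pd b sm) Uz).
rewrite (pd_mul a (sc 2) sN Uz) pd_cst mul0r add0r (pd_polar hB oU hY hp Uz) linearB !linearZ/=.
rewrite (pdC hB oU a b sY Uz); apply: (ip_ext hB') => w; rewrite !ipE'.
by ring.
Qed.
Local Notation psih := (polar_hat B a Y Yh psi).
Local Notation Psih := (fun z => model_point (psih z)).
Local Notation f z := (B (psi z) (Yh z)).

Lemma smooth_model_hat : smooth U Psih.
Proof. exact: smooth_model (smooth_polar_hat hB oU P). Qed.

Lemma model_hat_null z : U z -> B' (Psih z) (Psih z) = 0.
Proof. by move=> Uz; rewrite model_ip (polar_hat_norm hB P)// psi_c// subrr. Qed.

Lemma model_hat_cross z : U z ->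
  B' (Z z) (Psih z) = N z * hat_height B a Y Yh psi z * f z.
Proof.
by move=> Uz; rewrite (ipZl hB') model_ip (polar_hat_psi hB P)// psi_c//; ring.
Qed.

Lemma model_hat_dd d d' z : U z ->
  B' (pd d Psih z) (pd d' Psih z) = B (pd d psih z) (pd d' psih z).
Proof.
by move=> Uz; have s := smooth_polar_hat hB oU P; rewrite !pd_model// JJ.
Qed.

(** The Darboux condition, before passing to the light cone.  Besides psi_b only
the difference psih - psi occurs, and differences are the same for the points
[model_point psih] and [model_point psi]. *)
Lemma pd_polar_hat_darboux z : U z -> pd a psih z =
  (pd a mu z / mu z - B (Yh z) (pd a Y z)) *: (psih z - psi z) +
  (f z / (2 * hopf_height B b Y psi z)) *: pd b psi z.
Proof.
move=> Uz; rewrite (pd_polar_hat hB oU P Uz).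
rewrite (pd_polar hB oU (null_frame_sym hB hY) (polar_section_sym eps2 hp) Uz).
have -> : pd a (hopf_height B b Y psi) z = eps * pd a mu z.
  rewrite (pd_eq_on a oU (fun x Ux => polar_pair_hopf hB oU eps2 P Ux) Uz).
  by rewrite (pd_mul a (@smooth_cst R (R * R)%type R U eps) (smooth_pair_hopf hB oU P) Uz) pd_cst mul0r add0r.
rewrite (polar_pair_hopf hB oU eps2 P Uz) /polar_hat /partner_proj.
have m0 := pp_hopf P Uz; have e0' := eps_neq0 eps2.
have -> : pd a (hat_height B a Y Yh psi) z = pd a mu z * hat_height B a Y Yh psi z / mu z.
  by rewrite -(pd_hat_height hB oU eps2 P Uz) mulrAC mulfV// mul1r.
apply: (ip_ext hB) => w; rewrite !ipE.
move: (hat_height B a Y Yh psi z) (mu z) m0 (pd a mu z) (f z) => r m m0 dm F.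
by field; rewrite m0 e0'.
Qed.

Lemma pd_model_hat z : U z -> exists x y t : R,
  pd a Psih z = x *: Psih z + y *: Z z + t *: pd b Z z.
Proof.
move=> Uz; have N0 := model_scale_neq0 Uz.
rewrite pd_model_lift// (pd_model a (smooth_polar_hat hB oU P) Uz) pd_polar_hat_darboux//.
set th := _ - B (Yh z) _; set l := f z / _.
rewrite linearD !linearZ/= linearB.
exists th, (- th / N z - l / N z * pd b N z / N z), (l / N z); rewrite /model_lift.
apply: (ip_ext hB') => w; rewrite !ipE'.
by move: th l (N z) N0 (pd b N z) => th l n n0 dn; field.
Qed.
End Frame.

Section Adapted.
Variables (a b : R * R) (Y Yh psi : R * R -> V).
Hypothesis P : polar_pair B U eps a b Y Yh psi.
Hypothesis psi_c : forall z, U z -> B (psi z) (psi z) = c.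
Let hY := pp_frame P.
Let hp := pp_polar P.
Let sp := ps_smooth hp.
Let P' := polar_pair_sym hB oU eps2 P.
Local Notation Z := (model_lift a Y psi).
Local Notation mu := (hopf_height B a Y psi).

Lemma model_scale_sym z : U z -> model_scale b Y psi z = eps * model_scale a Y psi z.
Proof.
move=> Uz; rewrite /model_scale (polar_pair_hopf hB oU eps2 P Uz).
have e0' := eps_neq0 eps2; rewrite !invfM mulrCA; congr (_ * _).
by apply: (mulIf e0'); rewrite mulVf// eps2.
Qed.

Lemma model_null_frame : null_frame B' U a (eps *: b) Z.
Proof.
have sZ := smooth_model_lift P.
have dd := model_lift_dd P psi_c.
have e x := @pd_dirZ R V' U eps b Z x sZ.
split=> // z Uz.
- by rewrite (model_lift_null a Y psi_c).
- by rewrite dd// (dpsi_null P)// mulr0.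
- by rewrite e// !ipE' dd// (dpsi_null P')// !mulr0.
- rewrite e// !ipE' dd// (dpsi_cross P)// (polar_pair_hopf hB oU eps2 P Uz).
  transitivity (eps * eps * (2 * mu z * model_scale a Y psi z) ^+ 2 / 2); first by field.
  by rewrite eps2 (scale_mu P)//; field.
Qed.

(** The instances of [pd_pd_model_lift] for the two directions are subtracted.
The lift attached to [b] is [eps] times the one attached to [a], so the left
member of the second is eps Z_bb. *)
Lemma model_isothermic z : U z -> exists t : R,
  pd a (pd a Z) z = eps *: pd (eps *: b) (pd (eps *: b) Z) z + t *: Z z.
Proof.
move=> Uz; have sZ := smooth_model_lift P; have sZ' := smooth_model_lift P'.
have sN := smooth_model_scale P; have sm := (smooth_pair_hopf hB oU P).
have sc k := @smooth_cst R (R * R)%type R U k.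
have eb : pd (eps *: b) (pd (eps *: b) Z) z = pd b (pd b Z) z.
  rewrite (pd_dirZ eps b (smooth_pd _ sZ) Uz).
  rewrite (pd_eq_on b oU (fun x Ux => pd_dirZ eps b sZ Ux) Uz).
  by rewrite (pd_scale b (sc eps) (smooth_pd b sZ) Uz) pd_cst scale0r add0r scalerA eps2 scale1r.
have es x : U x -> model_lift b Y psi x = eps *: Z x.
  by move=> Ux; rewrite /model_lift model_scale_sym// scalerA.
have eps_pd d x : U x -> pd d (model_lift b Y psi) x = eps *: pd d Z x.
  move=> Ux; rewrite (pd_eq_on d oU es Ux) (pd_scale d (sc eps) sZ Ux).
  by rewrite pd_cst scale0r add0r.
have -> : eps *: pd (eps *: b) (pd (eps *: b) Z) z = pd b (pd b (model_lift b Y psi)) z.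
  rewrite eb (pd_eq_on b oU (eps_pd b) Uz) (pd_scale b (sc eps) (smooth_pd b sZ) Uz).
  by rewrite pd_cst scale0r add0r.
have eps_pdN d x : U x -> pd d (model_scale b Y psi) x = eps * pd d (model_scale a Y psi) x.
  move=> Ux; rewrite (pd_eq_on d oU model_scale_sym Ux) (pd_mul d (sc eps) sN Ux).
  by rewrite pd_cst mul0r add0r.
have eps_pdm d x : U x -> pd d (hopf_height B b Y psi) x = eps * pd d mu x.
  move=> Ux; rewrite (pd_eq_on d oU (fun x Ux => polar_pair_hopf hB oU eps2 P Ux) Ux).
  by rewrite (pd_mul d (sc eps) sm Ux) pd_cst mul0r add0r.
have eps_pdmb : pd b (pd a (hopf_height B b Y psi)) z = eps * pd a (pd b mu) z.
  rewrite (pd_eq_on b oU (eps_pdm a) Uz) (pd_mul b (sc eps) (smooth_pd a sm) Uz).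
  by rewrite pd_cst mul0r add0r (pdC (mul_inner_product R) oU a b sm Uz).
exists ((pd a (pd a (model_scale a Y psi)) z - pd b (pd b (model_scale b Y psi)) z) * (2 * mu z)).
rewrite (pd_pd_model_lift P)// (pd_pd_model_lift P')//.
rewrite (eps_pdN b)// (eps_pdm a)// eps_pdmb model_scale_sym// (polar_pair_hopf hB oU eps2 P Uz).
rewrite (pdC hB oU a b (nf_smooth hY) Uz) !(pd_model_scale P)//.
have s1 := scale_mu P Uz; rewrite /model_lift scalerA -[_ * _ * model_scale _ _ _ _]mulrA s1 mulr1.
apply: (ip_ext hB') => w; rewrite !ipE'.
have -> : mu z = (2 * model_scale a Y psi z)^-1.
  by rewrite /model_scale; have := pp_hopf P Uz; move: (mu z) => m m0; field.
have n0 := model_scale_neq0 P Uz.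
(* The identity holds modulo eps^2 = 1, which is not a field identity. *)
have [e1|e1] : eps = 1 \/ eps = -1.
  by have /eqP := eps2; rewrite -expr2 sqrf_eq1 => /orP[]/eqP; [left|right].
- by rewrite e1; field.
- by rewrite e1; field.
Qed.

Local Notation Psih := (fun z => model_point (polar_hat B a Y Yh psi z)).

Lemma pd_model_hat_span z : U z ->
  (exists x y t : R, pd a Psih z = x *: Psih z + y *: Z z + t *: pd (eps *: b) Z z) /\
  (exists x y t : R, pd (eps *: b) Psih z = x *: Psih z + y *: Z z + t *: pd a Z z).
Proof.
move=> Uz; have sZ := smooth_model_lift P; have sh := smooth_model_hat P.
split.
  have [x [y [t ->]]] := pd_model_hat P Uz; exists x, y, (t * eps).
  by rewrite (pd_dirZ eps b sZ Uz) scalerA -mulrA eps2 mulr1.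
have [x [y [t]]] := pd_model_hat P' Uz.
have sc := @smooth_cst R (R * R)%type R U eps.
have es w : U w -> model_lift b Y psi w = eps *: Z w.
  by move=> Uw; rewrite /model_lift model_scale_sym// scalerA.
have eh w : U w -> model_point (polar_hat B b Y Yh psi w) = Psih w.
  by move=> Uw; rewrite (polar_hat_sym hB oU eps2 P).
rewrite (pd_eq_on a oU es Uz) (pd_scale a sc sZ Uz) pd_cst scale0r add0r es//.
rewrite (pd_eq_on b oU eh Uz) eh// (pd_dirZ eps b sh Uz) => ->.
exists (eps * x), (eps * y * eps), (eps * t * eps).
by rewrite !scalerDr !scalerA.
Qed.

Lemma model_hat_metric z : U z ->
  [/\ B' (pd a Psih z) (pd a Psih z) = 0,
      B' (pd (eps *: b) Psih z) (pd (eps *: b) Psih z) = 0 &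
      B' (pd a Psih z) (pd (eps *: b) Psih z) = eps * B (psi z) (Yh z) ^+ 2 / 2].
Proof.
move=> Uz; have sh := smooth_model_hat P.
have hd := pp_partner P.
rewrite (pd_dirZ eps b sh Uz) !(ipZl hB', ipZr hB') !(model_hat_dd P)//.
have [t et] := pd_polar_hat_parallel hB oU eps2 P Uz.
have [t' et'] := pd_polar_hat_parallel hB oU eps2 P' Uz.
rewrite -(pd_eq_on b oU (fun x Ux => polar_hat_sym hB oU eps2 P Ux) Uz) et et'.
rewrite !ipE (dp_hh hd)// (pd_partner_norm hB oU hY hd)//.
rewrite (pd_partner_norm hB oU (null_frame_sym hB hY) (darboux_partner_sym hd))//.
rewrite (pd_partner_cross hB oU (null_frame_sym hB hY) (darboux_partner_sym hd))//.
rewrite !(ip_sym hB _ (Yh z)) !(null_cst_self hB oU _ (dp_smooth hd) (dp_hh hd))//.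
have g0 := pp_coeff P Uz; have g0' := pp_coeff P' Uz.
by split; field; rewrite ?g0 ?g0'.
Qed.
End Adapted.
End Model.

(** * Restricting and reflecting charts *)

Lemma smooth_id (R : realType) (E : normedModType R) (U : set E) : smooth U (@idfun E).
Proof.
case=> [|k]; first by split=> // x _; by apply: linear_differentiable => y; exact: cvg_id.
split=> [x _|a]; first by apply: linear_differentiable => y; exact: cvg_id.
have -> : (fun x => 'D_a (@idfun E) x) = (fun _ => a) by apply/funext => x; rewrite derive_id.
exact: itd_cst.
Qed.

Lemma smooth_open_neq0 (R : realType) (E : normedModType R) (U : set E) (f : E -> R) :
  open U -> smooth U f -> open (U `&` [set z | f z != 0]).
Proof.
move=> oU sf; rewrite openE => z [Uz fz]; apply: filterI; first exact: open_nbhs_nbhs.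
have cf : {for z, continuous f} by exact/differentiable_continuous/(smooth_diff sf Uz).
by apply: (cf [set x | x != 0]); apply: open_nbhs_nbhs; split=> //; exact: open_neq.
Qed.

Section Flip.
Variable R : realType.

(** The reflection v -> - v for [e = -1] and the identity for [e = 1]. *)
Definition flip (e : R) (z : R * R) : R * R := (z.1, e * z.2).

Lemma flip_is_linear e : linear (flip e).
Proof.
move=> t x y; apply: injective_projections => //=.
by rewrite mulrDr; congr (_ + _); rewrite /GRing.scale/= mulrCA.
Qed.
HB.instance Definition _ e := GRing.isLinear.Build R (R * R)%type (R * R)%type _ (flip e) (flip_is_linear e).

Lemma flip_continuous e : continuous (flip e).
Proof.
move=> z; have c1 : (fun w : R * R => w.1) @ z --> z.1 by exact: cvg_fst.
have c2 : (fun w : R * R => w.2) @ z --> z.2 by exact: cvg_snd.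
exact: (cvg_pair c1 (cvgM (cvg_cst e) c2)).
Qed.

Lemma flipK e : e * e = 1 -> involutive (flip e).
Proof. by move=> ee [u v]; rewrite /flip/= mulrA ee mul1r. Qed.

Lemma smooth_flip e U : open U -> smooth U (flip e).
Proof. by move=> oU; exact: (smooth_linear (@flip_continuous e) oU (@smooth_id R _ U)). Qed.

Lemma pd_flip (F : normedModType R) e a (f : R * R -> F) z :
  pd a (f \o flip e) z = pd (flip e a) f (flip e z).
Proof.
rewrite !pdE /derive.
have -> : (fun h => h^-1 *: ((f \o flip e \o shift z) (h *: a) - (f \o flip e) z)) =
    (fun h => h^-1 *: ((f \o shift (flip e z)) (h *: flip e a) - f (flip e z))).
  by apply/funext => h /=; rewrite linearP.
by [].
Qed.
End Flip.

Section Charts.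
Variables (R : realType) (M : smooth_surface R).
Implicit Types k : chart R M.

Definition overlap k1 k2 : set (R * R) :=
  cdom k1 `&` cpar k1 @^-1` (cpar k2 @` cdom k2).

Lemma open_preimage_chart k (O : set M) : open O -> open (cdom k `&` cpar k @^-1` O).
Proof.
move=> oO; rewrite openE => z [kz Oz]; apply: filterI.
  by apply: open_nbhs_nbhs; split=> //; exact: cdom_open.
by apply: (cpar_continuous kz); apply: open_nbhs_nbhs; split.
Qed.

Lemma open_overlap k1 k2 : open (overlap k1 k2).
Proof. by apply/open_preimage_chart/cpar_open => //; exact: cdom_open. Qed.

Lemma overlapP k1 k2 z : overlap k1 k2 z ->
  cdom k2 ((ccoord k2 \o cpar k1) z) /\ cpar k2 ((ccoord k2 \o cpar k1) z) = cpar k1 z.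
Proof. by case=> kz [w kw e] /=; rewrite -e cparK. Qed.

Lemma smooth_overlap k1 k2 : atlas k1 -> atlas k2 ->
  smooth (overlap k1 k2) (ccoord k2 \o cpar k1).
Proof. by move=> a1 a2; have [] := atlas_compatible a1 a2. Qed.

Section FlipChart.
Variables (k : chart R M) (D : set (R * R)) (e : R).
Hypotheses (oD : open D) (Dk : D `<=` cdom k) (ee : e * e = 1).

Lemma flip_dom_open : open (flip e @^-1` D).
Proof. by apply: open_comp => // z _; exact: flip_continuous. Qed.

Lemma flip_parK z : (flip e @^-1` D) z -> (flip e \o ccoord k) ((cpar k \o flip e) z) = z.
Proof. by move=> Dz /=; rewrite cparK ?flipK//; exact: Dk. Qed.

Lemma flip_par_continuous z : (flip e @^-1` D) z -> {for z, continuous (cpar k \o flip e)}.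
Proof.
move=> Dz; apply: continuous_comp; first exact: flip_continuous.
exact: (cpar_continuous (Dk Dz)).
Qed.

Lemma flip_par_open A : open A -> A `<=` flip e @^-1` D -> open ((cpar k \o flip e) @` A).
Proof.
move=> oA AD; have -> : (cpar k \o flip e) @` A = cpar k @` (flip e @^-1` A).
  by apply/seteqP; split=> _ [z Az <-]; exists (flip e z) => //=; rewrite flipK.
apply: cpar_open; first by apply: open_comp => // z _; exact: flip_continuous.
by move=> z Az; apply: Dk; rewrite -(flipK ee z); exact: AD.
Qed.

(** The chart [k] restricted to [D], in the coordinates (u, e v). *)
Definition flip_chart : chart R M :=
  Chart flip_dom_open flip_parK flip_par_continuous flip_par_open.

(** The atlas is maximal, and composition with a reflection keeps transition
maps smooth. *)
Lemma flip_chart_atlas : atlas k -> atlas flip_chart.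
Proof.
move=> ak; apply: atlas_maximal => k' ak'; split.
  have sk := smooth_overlap ak ak'.
  have oF := @open_overlap flip_chart k'.
  apply: (smooth_comp (t := flip e) (f := ccoord k' \o cpar k) oF _ _ sk).
    by move=> z [Dz Oz]; split=> //; exact: Dk.
  exact: smooth_flip.
have sk : smooth (overlap k' flip_chart) (ccoord k \o cpar k').
  apply: smooth_sub (smooth_overlap ak' ak) => z [kz [w Dw e']]; split=> //.
  by exists (flip e w); [exact: Dk|].
exact: (smooth_linear (@flip_continuous R e) (@open_overlap k' flip_chart) sk).
Qed.
End FlipChart.
End Charts.

(** * Changes of charts *)

Lemma pd_comp (R : realType) (F : normedModType R) (U V : set (R * R)) (t : R * R -> R * R)
    (f : R * R -> F) a z :
  smooth U t -> smooth V f -> U z -> V (t z) -> pd a (f \o t) z = pd (pd a t z) f (t z).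
Proof.
move=> st sf Uz Vz; rewrite !pdE derive_comp//; [exact: smooth_diff st Uz|exact: smooth_diff sf Vz].
Qed.

Section ChartChange.
Variables (R : realType) (M : smooth_surface R) (k1 k2 : chart R M) (z1 z2 : R * R).
Hypotheses (a1 : atlas k1) (a2 : atlas k2) (d1 : cdom k1 z1) (d2 : cdom k2 z2).
Hypothesis e12 : cpar k1 z1 = cpar k2 z2.

(** The differential at [z2] of the change from the coordinates [k2] to [k1]. *)
Definition jacobian (a : R * R) : R * R := pd a (ccoord k1 \o cpar k2) z2.

Lemma overlap_pt : overlap k2 k1 z2.
Proof. by split=> //; exists z1. Qed.

Lemma ccoord_pt : ccoord k1 (cpar k2 z2) = z1.
Proof. by rewrite -e12 cparK. Qed.

Lemma pd_chart_change (F : normedModType R) (f : M -> F) a :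
  smooth (cdom k1) (f \o cpar k1) -> pd a (f \o cpar k2) z2 = pd (jacobian a) (f \o cpar k1) z1.
Proof.
move=> sf; have oO := @open_overlap R M k2 k1.
have e x : overlap k2 k1 x -> (f \o cpar k2) x = ((f \o cpar k1) \o (ccoord k1 \o cpar k2)) x.
  by move=> /overlapP[_ ex]; rewrite /= ex.
rewrite (pd_eq_on a oO e overlap_pt).
rewrite (pd_comp a (smooth_overlap a2 a1) sf overlap_pt); last by rewrite /= ccoord_pt.
by rewrite [X in pd _ _ X]ccoord_pt.
Qed.

Lemma smooth_chart_change (F : normedModType R) (f : M -> F) :
  smooth (cdom k1) (f \o cpar k1) -> smooth (overlap k2 k1) (f \o cpar k2).
Proof.
move=> sf; have oO := @open_overlap R M k2 k1.
have s : smooth (overlap k2 k1) ((f \o cpar k1) \o (ccoord k1 \o cpar k2)).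
  apply: (smooth_comp oO _ (smooth_overlap a2 a1) sf) => x /overlapP[] //.
by apply: (smooth_eq_on oO _ s) => x /overlapP[_ ex]; rewrite /= ex.
Qed.

(** Two lifts are proportional, Y2 = w Y1; the factor is smooth because it is
the quotient of the pairings of Y2 and Y1 with a constant vector.  The term
[t *: Y1 z1] comes from the derivative of [w]. *)
Lemma lift_change (V : normedModType R) (B : V -> V -> R) (y : M -> set V) Y1 Y2 :
  inner_product B -> Defs.lift B k1 y Y1 -> Defs.lift B k2 y Y2 ->
  exists2 w : R, w != 0 & Y2 z2 = w *: Y1 z1 /\
    forall a, exists t : R, pd a Y2 z2 = w *: pd (jacobian a) Y1 z1 + t *: Y1 z1.
Proof.
move=> hB [s1 l1] [s2 l2]; have oO := @open_overlap R M k2 k1.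
pose F := Y1 \o (ccoord k1 \o cpar k2).
have sF : smooth (overlap k2 k1) F.
  by apply: (smooth_comp oO _ (smooth_overlap a2 a1) s1) => x /overlapP[].
(* The smooth factor of proportionality is computed by pairing with a fixed e. *)
have [e he] : exists e, B (Y1 z1) e != 0.
  apply: contrapT => /forallNP h; have [n0 _ _] := l1 _ d1; apply: n0.
  by apply: (ip_nondegenerate hB) => e; apply: contrapT => /eqP; exact: h.
pose h x := B (F x) e.
have se U := @smooth_cst R (R * R)%type V U e.
have sh : smooth (overlap k2 k1) h by exact: smooth_ip.
pose N := overlap k2 k1 `&` [set x | h x != 0].
have oN : open N by exact: smooth_open_neq0.
have Fz : F z2 = Y1 z1 by rewrite /F /= ccoord_pt.
have Nz : N z2 by split; [exact: overlap_pt|rewrite /h/= Fz].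
have NO : N `<=` overlap k2 k1 by move=> x [].
have shN := smooth_sub NO sh.
have N2 : N `<=` cdom k2 by move=> x [[]].
have s2N := smooth_sub N2 s2.
pose w x := B (Y2 x) e / h x.
have sw : smooth N w.
  apply: smoothM => //; first exact: smooth_ip.
  by apply: smoothV => // x [].
have Y2F x : N x -> Y2 x = w x *: F x.
  move=> [Ox hx]; have [k1x ex] := overlapP Ox; have [_ _ e1] := l1 _ k1x.
  have [_ _ e2] := l2 _ Ox.1; rewrite ex e2 in e1.
  have : proj_pt (Y2 x) (Y2 x) by exists 1 => //; rewrite scale1r.
  rewrite e1 => -[s _ es]; have es' : Y2 x = s *: F x by rewrite -es.
  by rewrite /w es' (ipZl hB) -/(h x) mulfK.
have eY := Y2F _ Nz; rewrite Fz in eY.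
exists (w z2).
  by apply/eqP => w0; have [n0 _ _] := l2 _ d2; apply: n0; rewrite eY w0 scale0r.
split=> // a; exists (pd a w z2).
rewrite (pd_eq_on a oN Y2F Nz) (pd_scale a sw (smooth_sub NO sF) Nz) Fz addrC; congr (_ + _).
rewrite (pd_comp a (smooth_overlap a2 a1) s1 overlap_pt) ?[X in pd _ _ X]ccoord_pt//.
by rewrite /= ccoord_pt.
Qed.
End ChartChange.

Lemma jacobianK (R : realType) (M : smooth_surface R) (k1 k2 : chart R M) z1 z2 a :
  atlas k1 -> atlas k2 -> cdom k1 z1 -> cdom k2 z2 -> cpar k1 z1 = cpar k2 z2 ->
  jacobian k1 k2 z2 (jacobian k2 k1 z1 a) = a.
Proof.
move=> a1 a2 d1 d2 e12; have O2 := overlap_pt d1 d2 e12.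
have O1 := overlap_pt d2 d1 (esym e12).
have oO := @open_overlap R M k1 k2.
rewrite /jacobian -(ccoord_pt d2 (esym e12)).
rewrite -(pd_comp a (smooth_overlap a1 a2) (smooth_overlap a2 a1) O1); last first.
  by rewrite /= (ccoord_pt d2 (esym e12)).
rewrite (@pd_eq_on _ _ _ a _ idfun _ oO _ O1); last first.
  by move=> x Ox /=; have [_ /= ->] := overlapP Ox; rewrite cparK//; case: Ox.
by rewrite pdE derive_id.
Qed.

(** * The defining conditions in terms of null frames *)

Section Translation.
Variables (R : realType) (V : normedModType R) (B : V -> V -> R).
Hypothesis hB : inner_product B.
Let ipE := (ipDl hB, ipDr hB, ipNl hB, ipNr hB, ipZl hB, ipZr hB).
Local Notation eu := ((1, 0) : R * R).
Local Notation ev := ((0, 1) : R * R).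
Implicit Types (U : set (R * R)) (Y s : R * R -> V).

(** Being a parallel normal section, expressed with first derivatives, so that it
can be carried from one chart to another. *)
Record polar_at (a b : R * R) Y s z : Prop := PolarAt {
  pa_0 : B (s z) (Y z) = 0;
  pa_a : B (s z) (pd a Y z) = 0;
  pa_b : B (s z) (pd b Y z) = 0;
  pa_da : exists x y : R, pd a s z = x *: Y z + y *: pd b Y z;
  pa_db : exists x y : R, pd b s z = x *: Y z + y *: pd a Y z
}.

Lemma normalP Y z x : normal B Y z x <->
  [/\ B x (Y z) = 0, B x (pd eu Y z) = 0, B x (pd ev Y z) = 0 & B x (pd ev (pd eu Y) z) = 0].
Proof.
rewrite /normal /central !duE !dvE; split=> [h|[h0 h1 h2 h3] w].
  split; apply: h; apply/lin_span4.
  - by exists 1, 0, 0, 0; rewrite scale1r !scale0r !addr0.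
  - by exists 0, 1, 0, 0; rewrite scale1r !scale0r !addr0 add0r.
  - by exists 0, 0, 1, 0; rewrite scale1r !scale0r !addr0 !add0r.
  - by exists 0, 0, 0, 1; rewrite scale1r !scale0r !add0r.
by move=> /lin_span4[a [b [d [e ->]]]]; rewrite !ipE h0 h1 h2 h3; ring.
Qed.

(** In the central space, orthogonality to [Y] kills the coefficient of Y_uv, and
orthogonality of psi_u to Y_v the one of Y_u; the latter holds because psi is
orthogonal to Y_v and to Y_vu = Y_uv. *)
Lemma parallel_polar_at U Y s z : open U -> null_frame B U eu ev Y -> smooth U s ->
  (forall x, U x -> [/\ normal B Y x (s x), normal_part B Y x (du s x) 0 &
    normal_part B Y x (dv s x) 0]) -> U z -> polar_at eu ev Y s z.
Proof.
move=> oU hY ss hs Uz; have sY := nf_smooth hY; have hY' := null_frame_sym hB hY.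
have n0 x : U x -> B (s x) (Y x) = 0 by move=> /hs[/normalP[]].
have n1 x : U x -> B (s x) (pd eu Y x) = 0 by move=> /hs[/normalP[]].
have n2 x : U x -> B (s x) (pd ev Y x) = 0 by move=> /hs[/normalP[]].
have n3 x : U x -> B (s x) (pd ev (pd eu Y) x) = 0 by move=> /hs[/normalP[]].
have sd0 d : B (s z) (pd d Y z) = 0 -> B (pd d s z) (Y z) = 0.
  by move=> h; have := pd_ip_cst hB oU d ss sY n0 Uz; rewrite h addr0.
have uv : B (pd eu s z) (pd ev Y z) = 0.
  have := pd_ip_cst hB oU eu ss (smooth_pd ev sY) n2 Uz.
  by rewrite (pdC hB oU eu ev sY Uz) n3// addr0.
have vu : B (pd ev s z) (pd eu Y z) = 0.
  by have := pd_ip_cst hB oU ev ss (smooth_pd eu sY) n1 Uz; rewrite n3// addr0.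
have [_ [_ cu] [_ cv]] := hs z Uz.
move: cu cv; rewrite !subr0 /central !duE !dvE.
move=> /lin_span4[a [b [d [e eqa]]]] /lin_span4[a' [b' [d' [e' eqb]]]].
have Yd0 dd := nf_0d hB oU hY dd Uz.
have Y0 := nf_00 hY Uz; have Ybb := nf_bb hY Uz; have Yaa := nf_aa hY Uz; have Yab := nf_ab hY Uz.
have Yuv := nf_0ba hB oU hY Uz.
have E0 : e = 0.
  have := sd0 eu (n1 _ Uz); rewrite eqa !ipE Y0 !(ip_sym hB _ (Y z)) !Yd0 Yuv => h; lra.
have E0' : e' = 0.
  have := sd0 ev (n2 _ Uz); rewrite eqb !ipE Y0 !(ip_sym hB _ (Y z)) !Yd0 Yuv => h; lra.
split; rewrite ?n0 ?n1 ?n2//.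
  exists a, d; have b0 : b = 0.
    move: uv; rewrite eqa E0 !ipE Yd0 Yab Ybb => h; lra.
  by rewrite eqa E0 b0 !scale0r !addr0.
exists a', b'; have d0 : d' = 0.
  move: vu; rewrite eqb E0' !ipE Yd0 Yaa (ip_sym hB (pd ev Y z)) Yab => h; lra.
by rewrite eqb E0' d0 !scale0r !addr0.
Qed.

Lemma polar_at_parallel U Y s z : open U -> null_frame B U eu ev Y -> smooth U s ->
  (forall x, U x -> polar_at eu ev Y s x) -> U z ->
  [/\ normal B Y z (s z), normal_part B Y z (du s z) 0 & normal_part B Y z (dv s z) 0].
Proof.
move=> oU hY ss hs Uz; have sY := nf_smooth hY; have [n0 n1 n2 [x [t e1]] [x' [t' e2]]] := hs z Uz.
have z0 : normal B Y z 0 by apply/normalP; rewrite !(ip0l hB).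
split.
- apply/normalP; split=> //.
  have := pd_ip_cst hB oU ev ss (smooth_pd eu sY) (fun x Ux => pa_a (hs x Ux)) Uz.
  by rewrite e2 !ipE (nf_0d hB oU hY)// (nf_aa hY)// !mulr0 !add0r.
- split=> //; rewrite subr0 /central !duE !dvE e1; apply/lin_span4.
  by exists x, 0, t, 0; rewrite !scale0r !addr0.
- split=> //; rewrite subr0 /central !duE !dvE e2; apply/lin_span4.
  by exists x', t', 0, 0; rewrite !scale0r !addr0.
Qed.

(** The equations of a null frame make Y_uu orthogonal to Y, Y_u and Y_v; the
scalar s_1 is then chosen to make kappa_1 orthogonal to Y_uv.  A relation
kappa_1 = eps kappa_2 + t Y follows, and t = 0 as <Y, Y_uv> <> 0. *)
Lemma null_frame_hopf (eps : R) U Y z : open U -> null_frame B U eu ev Y ->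
  (exists t : R, pd eu (pd eu Y) z = eps *: pd ev (pd ev Y) z + t *: Y z) -> U z ->
  exists kappa1 kappa2, hopf B Y z kappa1 kappa2 /\ kappa1 = eps *: kappa2.
Proof.
move=> oU hY [t et] Uz; have sY := nf_smooth hY; have hY' := null_frame_sym hB hY.
pose X := pd ev (pd eu Y) z.
pose m1 := B X (pd eu (pd eu Y) z); pose m2 := B X (pd ev (pd ev Y) z).
have XY : B X (Y z) = - 2^-1 by rewrite (ip_sym hB) (nf_0ba hB oU hY).
have XY' : B (Y z) X = - 2^-1 by rewrite (ip_sym hB).
exists (pd eu (pd eu Y) z + (2 * m1) *: Y z), (pd ev (pd ev Y) z + (2 * m2) *: Y z); split; last first.
  rewrite scalerDr scalerA et -addrA -scalerDl; congr (_ + _ *: _).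
  by rewrite /m1 et !ipE -/m2 XY; field.
split.
- apply/normalP; rewrite !ipE !(ip_sym hB (pd eu (pd eu Y) z)) (nf_0aa hB oU hY)// (nf_00 hY)//.
  rewrite (nf_a_da hB oU hY)// (nf_b_aa hB oU hY)// !(nf_0d hB oU hY)// -/X -/m1 XY'.
  by split; field.
- apply/normalP; rewrite !ipE !(ip_sym hB (pd ev (pd ev Y) z)) (nf_0aa hB oU hY')// (nf_00 hY)//.
  rewrite (nf_a_da hB oU hY')// (nf_b_aa hB oU hY')// !(nf_0d hB oU hY)// -/X -/m2 XY'.
  by split; field.
- by exists (4 * m1); rewrite !duE; apply: (ip_ext hB) => w; rewrite !ipE; field.
- by exists (4 * m2); rewrite !dvE; apply: (ip_ext hB) => w; rewrite !ipE; field.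
Qed.

Lemma null_lorentzian (F : normedModType R) (C : F -> F -> R) U (f : R * R -> F) z :
  inner_product C -> smooth U f -> U z ->
  C (pd eu f z) (pd eu f z) = 0 -> C (pd ev f z) (pd ev f z) = 0 ->
  C (pd eu f z) (pd ev f z) != 0 ->
  lorentzian (fun a b => C ('D_a f z) ('D_b f z)).
Proof.
move=> hC sf Uz uu vv uv; have vu := ip_sym hC (pd ev f z) (pd eu f z).
set h := C _ _ in uv vu.
have D (a b : R * R) : C ('D_a f z) ('D_b f z) = (a.1 * b.2 + a.2 * b.1) * h.
  have e (d : R * R) : 'D_d f z = pd d f z by rewrite pdE.
  rewrite !e (pd_plane a sf Uz) (pd_plane b sf Uz).
  rewrite !(ipDl hC, ipDr hC) !(ipZl hC, ipZr hC) uu vv vu -/h; ring.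
(* The metric is h (a_1 b_2 + a_2 b_1), so these vectors have norms 1 and -1. *)
by exists (1, (2 * h)^-1), (1, - (2 * h)^-1); rewrite !D /=; split; field.
Qed.
End Translation.

(** * Invariance under changes of charts *)

Lemma diagonal_or_antidiagonal (R : realType) (p1 p2 q1 q2 : R) :
  p1 * p2 = 0 -> q1 * q2 = 0 -> p1 * q2 + p2 * q1 != 0 ->
  [/\ p1 = 0, q2 = 0, p2 != 0 & q1 != 0] \/ [/\ p2 = 0, q1 = 0, p1 != 0 & q2 != 0].
Proof.
move=> /eqP + /eqP; rewrite !mulf_eq0 => /orP[]/eqP-> /orP[]/eqP->;
  rewrite ?mul0r ?mulr0 ?addr0 ?add0r ?eqxx// mulf_eq0 negb_or => /andP[? ?]; [left|right]; by split.
Qed.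

Section Transfer.
Variables (R : realType) (V : normedModType R) (B : V -> V -> R).
Hypothesis hB : inner_product B.
Let ipE := (ipDl hB, ipDr hB, ipNl hB, ipNr hB, ipZl hB, ipZr hB).
Variables (M : smooth_surface R) (k1 k2 : chart R M) (z1 z2 : R * R).
Hypotheses (a1 : atlas k1) (a2 : atlas k2) (d1 : cdom k1 z1) (d2 : cdom k2 z2).
Hypothesis e12 : cpar k1 z1 = cpar k2 z2.
Local Notation eu := ((1, 0) : R * R).
Local Notation ev := ((0, 1) : R * R).
Local Notation L := (jacobian k1 k2 z2).

(** Canonical lifts have null coordinate directions in both charts, so the
Jacobian is diagonal or antidiagonal.  In the second case the two conditions on
the derivatives are exchanged. *)
Lemma polar_at_change y Y1 Y2 (s : M -> V) :
  Defs.lift B k1 y Y1 -> Defs.lift B k2 y Y2 ->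
  null_frame B (cdom k1) eu ev Y1 -> null_frame B (cdom k2) eu ev Y2 ->
  smooth (cdom k1) (s \o cpar k1) ->
  polar_at B eu ev Y1 (s \o cpar k1) z1 -> polar_at B eu ev Y2 (s \o cpar k2) z2.
Proof.
move=> l1 l2 h1 h2 ss hp; have o1 : open (cdom k1) by exact: cdom_open.
have [w w0 [eY dY]] := lift_change a1 a2 d1 d2 e12 hB l1 l2.
have [n0 n1 n2 [x [t su]] [x' [t' sv]]] := hp.
have ds a := pd_chart_change a1 a2 d1 d2 e12 a ss.
have [tu dYu] := dY eu; have [tv dYv] := dY ev; have dsu := ds eu; have dsv := ds ev.
move: dYu dYv dsu dsv; rewrite !(pd_plane (L _) (nf_smooth h1) d1) !(pd_plane (L _) ss d1) su sv.
move: (L eu) (L ev) => [p1 p2] [q1 q2] /= dYu dYv dsu dsv.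
have Y00 := nf_00 h1 d1; have Yd0 d := nf_0d hB o1 h1 d d1.
have Yuu := nf_aa h1 d1; have Yvv := nf_bb h1 d1; have Yuv := nf_ab h1 d1.
have Yvu := etrans (ip_sym hB (pd ev Y1 z1) (pd eu Y1 z1)) Yuv.
have Yd0' d := etrans (ip_sym hB (pd d Y1 z1) (Y1 z1)) (Yd0 d).
have gE := (Y00, Yd0, Yd0', Yuu, Yvv, Yuv, Yvu).
have c1 : (w * w) * (p1 * p2) = 0.
  by have := nf_aa h2 d2; rewrite dYu !ipE !gE => h; lra.
have c2 : (w * w) * (q1 * q2) = 0.
  by have := nf_bb h2 d2; rewrite dYv !ipE !gE => h; lra.
have c3 : (w * w) * (p1 * q2 + p2 * q1) = 1.
  by have := nf_ab h2 d2; rewrite dYu dYv !ipE !gE => h; lra.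
have s0 : (s \o cpar k2) z2 = (s \o cpar k1) z1 by rewrite /= e12.
have ww : w * w != 0 by rewrite mulf_neq0.
have span (u3 : V) (p q m n l : R) : q != 0 -> exists X T : R,
    p *: (m *: Y1 z1 + n *: u3) = X *: (w *: Y1 z1) + T *: (w *: (q *: u3) + l *: Y1 z1).
  move=> q0; exists ((p * m - p * n / (w * q) * l) / w), (p * n / (w * q)).
  apply: (ip_ext hB) => v; rewrite !ipE.
  by move: (B u3 v) (B (Y1 z1) v) => ? ?; field; rewrite w0 q0.
have p12 : p1 * p2 = 0 by apply: (mulfI ww); rewrite c1 mulr0.
have q12 : q1 * q2 = 0 by apply: (mulfI ww); rewrite c2 mulr0.
have pq : p1 * q2 + p2 * q1 != 0.
  by apply: contra_eq_neq c3 => ->; rewrite mulr0 eq_sym oner_neq0.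
split; rewrite ?s0 ?dsu ?dsv ?dYu ?dYv ?eY ?ipE ?n0 ?n1 ?n2 ?mulr0 ?addr0 ?mulr0//.
- have [[-> -> p20 q10]|[-> -> p10 q20]] := diagonal_or_antidiagonal p12 q12 pq;
  by rewrite !scale0r add0r addr0; exact: span.
- have [[-> -> p20 q10]|[-> -> p10 q20]] := diagonal_or_antidiagonal p12 q12 pq;
  by rewrite !scale0r add0r addr0; exact: span.
Qed.

Lemma lift_d0 (k : chart R M) y Y z a : Defs.lift B k y Y -> cdom k z ->
  B (Y z) (pd a Y z) = 0.
Proof.
move=> [sY lY] kz; apply: (null_cst_self hB (@cdom_open _ _ k) a sY (k := 0)) => // x kx.
by have [] := lY _ kx.
Qed.

(** Otherwise the metric would vanish in the second chart, hence in the first,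
where it is Lorentzian. *)
Lemma timelike_change y F1 F2 : Defs.lift B k1 y F1 -> Defs.lift B k2 y F2 ->
  lorentzian (fun a b => B ('D_a F1 z1) ('D_b F1 z1)) ->
  B (pd eu F2 z2) (pd eu F2 z2) = 0 -> B (pd ev F2 z2) (pd ev F2 z2) = 0 ->
  B (pd eu F2 z2) (pd ev F2 z2) != 0.
Proof.
move=> l1 l2 [b1 [_ [b1n _ _]]] uu vv; apply/eqP => uv.
have vu := etrans (ip_sym hB (pd ev F2 z2) (pd eu F2 z2)) uv.
have [w w0 [eY dY]] := lift_change a1 a2 d1 d2 e12 hB l1 l2.
have := jacobianK b1 a1 a2 d1 d2 e12; set a := jacobian k2 k1 z1 b1 => La.
have [t da] := dY a; rewrite La in da.
have b1n' : B (pd b1 F1 z1) (pd b1 F1 z1) = 1 by rewrite pdE.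
have [_ F00 _] := l1.2 _ d1.
have n0 : B (pd a F2 z2) (pd a F2 z2) = 0.
  by rewrite (pd_plane a l2.1 d2) !ipE uu vv uv vu; ring.
move: n0; rewrite da !ipE b1n' F00 (ip_sym hB _ (F1 z1)) (lift_d0 b1 l1 d1) => h.
have /eqP : w * w = 0 by lra.
by rewrite mulf_eq0 orbb (negPf w0).
Qed.
End Transfer.

Section HatChange.
Variables (R : realType) (V : normedModType R) (B : V -> V -> R).
Hypothesis hB : inner_product B.
Let ipE := (ipDl hB, ipDr hB, ipNl hB, ipNr hB, ipZl hB, ipZr hB).
Variable eps : R.
Hypothesis eps2 : eps * eps = 1.
Local Notation eu := ((1, 0) : R * R).
Local Notation ev := ((0, 1) : R * R).

Lemma hat_height_span_dir U a b Y Yh psi z : open U ->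
  polar_pair B U eps a b Y Yh psi -> U z -> exists x t : R,
  pd a psi z + hat_height B a Y Yh psi z *: pd a Yh z = x *: Y z + t *: Yh z.
Proof.
move=> oU P Uz; have hY := pp_frame P.
rewrite (pd_polar hB oU hY (pp_polar P) Uz) (pd_partner hB oU hY (pp_partner P) Uz).
have e := hat_heightE P Uz; set rho := hat_height _ _ _ _ _ _ in e *.
exists (2 * pd b (hopf_height B a Y psi) z - 2 * hopf_height B a Y psi z * B (Yh z) (pd b Y z)),
  (- rho * B (Yh z) (pd a Y z)).
apply: (ip_ext hB) => w; rewrite !ipE.
have -> : hopf_height B a Y psi z = rho * darboux_coeff B a Y Yh z / 2 by rewrite e; field.
by field.
Qed.

(** The first-order property that determines the coefficient of [Yh] in the polar
surface; unlike its definition it does not refer to coordinates. *)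
Lemma hat_height_span U Y Yh psi z a : open U ->
  polar_pair B U eps eu ev Y Yh psi -> U z -> exists x t : R,
  pd a psi z + hat_height B eu Y Yh psi z *: pd a Yh z = x *: Y z + t *: Yh z.
Proof.
move=> oU P Uz; have [x [t e]] := hat_height_span_dir oU P Uz.
have [x' [t']] := hat_height_span_dir oU (polar_pair_sym hB oU eps2 P) Uz.
rewrite (hat_height_sym hB oU eps2 P Uz) => e'.
rewrite (pd_plane a (ps_smooth (pp_polar P)) Uz) (pd_plane a (dp_smooth (pp_partner P)) Uz).
exists (a.1 * x + a.2 * x'), (a.1 * t + a.2 * t').
transitivity (a.1 *: (x *: Y z + t *: Yh z) + a.2 *: (x' *: Y z + t' *: Yh z)).
  by rewrite -e -e'; apply: (ip_ext hB) => w; rewrite !ipE; ring.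
by apply: (ip_ext hB) => w; rewrite !ipE; ring.
Qed.

Variables (M : smooth_surface R) (k1 k2 : chart R M) (z1 z2 : R * R).
Hypotheses (a1 : atlas k1) (a2 : atlas k2) (d1 : cdom k1 z1) (d2 : cdom k2 z2).
Hypothesis e12 : cpar k1 z1 = cpar k2 z2.
Local Notation L := (jacobian k1 k2 z2).

(** The term <psi, Yh> Y only depends on the lines of [Y] and [Yh], by
<Y, Yh> = 1.  By [hat_height_span] in both charts, the difference of the two
multiples of [Yh] has derivatives in Span(Y, Yh), so it vanishes because Yh_u is
not in this span. *)
Lemma polar_hat_change y yh Y1 Y2 Yh1 Yh2 (psi : M -> V) :
  Defs.lift B k1 y Y1 -> Defs.lift B k2 y Y2 ->
  Defs.lift B k1 yh Yh1 -> Defs.lift B k2 yh Yh2 ->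
  polar_pair B (cdom k1) eps eu ev Y1 Yh1 (psi \o cpar k1) ->
  polar_pair B (cdom k2) eps eu ev Y2 Yh2 (psi \o cpar k2) ->
  polar_hat B eu Y1 Yh1 (psi \o cpar k1) z1 = polar_hat B eu Y2 Yh2 (psi \o cpar k2) z2.
Proof.
move=> l1 l2 lh1 lh2 P1 P2; have o1 : open (cdom k1) by exact: cdom_open.
have o2 : open (cdom k2) by exact: cdom_open.
have [w w0 [eY _]] := lift_change a1 a2 d1 d2 e12 hB l1 l2.
have [w' w0' [eYh dYh]] := lift_change a1 a2 d1 d2 e12 hB lh1 lh2.
have hd1 := pp_partner P1.
have ww : w * w' = 1.
  by have := dp_0h (pp_partner P2) d2; rewrite eY eYh !ipE (dp_0h hd1)// mulr1.
have := jacobianK eu a1 a2 d1 d2 e12; set a := jacobian k2 k1 z1 eu => La.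
have [t da] := dYh a; rewrite La in da.
have ds : pd a (psi \o cpar k2) z2 = pd eu (psi \o cpar k1) z1.
  by rewrite -La; exact: (pd_chart_change a1 a2 d1 d2 e12 a (ps_smooth (pp_polar P1))).
have [x [m]] := hat_height_span a o2 P2 d2; rewrite ds da eY eYh.
have [x' [m']] := hat_height_span eu o1 P1 d1.
rewrite /polar_hat /partner_proj eY eYh.
set r1 := hat_height _ _ _ _ _ _; set r2 := hat_height _ _ _ _ _ _ => E1 E2.
have r12 : r1 = r2 * w'.
  have h0 := dp_0h hd1 d1; have hh := dp_hh hd1 d1.
  have hd d : B (pd d Yh1 z1) (Yh1 z1) = 0.
    by rewrite (ip_sym hB); exact: (lift_d0 hB d lh1 d1).
  have cr := pd_partner_cross hB o1 (pp_frame P1) hd1 d1.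
  have g0 := pp_coeff P1 d1.
  have g0' := pp_coeff (polar_pair_sym hB o1 eps2 P1) d1.
  have F1 := congr1 (B ^~ (Yh1 z1)) E1; have F2 := congr1 (B ^~ (Yh1 z1)) E2.
  have G1 := congr1 (B ^~ (pd ev Yh1 z1)) E1; have G2 := congr1 (B ^~ (pd ev Yh1 z1)) E2.
  rewrite /= in F1 F2 G1 G2; move: F1 F2 G1 G2; rewrite !ipE hh h0 hd cr.
  rewrite (ip_sym hB (Yh1 z1) (pd ev _ _)) hd => F1 F2 G1 G2.
  have xx : x' = x * w by lra.
  apply: (mulIf g0); apply: (mulIf g0').
  by move: G1 G2; rewrite xx => G1 G2; lra.
rewrite r12 /= -!e12; apply: (ip_ext hB) => v; rewrite !ipE.
have -> : w = w'^-1 by apply: (mulIf w0'); rewrite ww mulVf.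
by field.
Qed.

(** The kernel of the differential is transported by the Jacobian, which is
injective. *)
Lemma immersed_chart (c : R) (f : M -> V) : smooth (cdom k1) (f \o cpar k1) ->
  (forall a : R * R,
    (if c == 0 then proj_pt (f (cpar k1 z1)) else [set 0]) (pd a (f \o cpar k1) z1) -> a = 0) ->
  forall a : R * R,
    (if c == 0 then proj_pt (f (cpar k1 z1)) else [set 0]) (pd a (f \o cpar k2) z2) -> a = 0.
Proof.
move=> sf im a; rewrite (pd_chart_change a1 a2 d1 d2 e12 a sf) => /im La.
rewrite -(jacobianK a a2 a1 d2 d1 (esym e12)) La /jacobian pdE derive0//.
Qed.
End HatChange.

(** * Darboux charts *)

Section Lifts.
Variables (R : realType) (V : normedModType R) (B : V -> V -> R).
Hypothesis hB : inner_product B.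
Let ipE := (ipDl hB, ipDr hB, ipNl hB, ipNr hB, ipZl hB, ipZr hB).
Variable M : smooth_surface R.
Implicit Types (k : chart R M) (y : M -> set V) (Y : R * R -> V).
Local Notation eu := ((1, 0) : R * R).
Local Notation ev := ((0, 1) : R * R).

Lemma proj_ptZ (t : R) (x : V) : t != 0 -> proj_pt (t *: x) = proj_pt x.
Proof.
move=> t0; apply/seteqP; split=> _ [s _ <-]; first by exists (s * t); rewrite ?scalerA.
by exists (s / t) => //; rewrite scalerA divfK.
Qed.

Lemma lift_scale k y Y (N : R * R -> R) : Defs.lift B k y Y -> smooth (cdom k) N ->
  (forall z, cdom k z -> N z != 0) -> Defs.lift B k y (fun z => N z *: Y z).
Proof.
move=> [sY lY] sN N0; split=> [|z kz]; first by apply: smoothZ => //; exact: cdom_open.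
have [Y0 YY yY] := lY z kz; split.
- by apply/eqP; rewrite scaler_eq0 negb_or N0//=; apply/eqP.
- by rewrite !ipE YY !mulr0.
- by rewrite proj_ptZ// N0.
Qed.

Lemma canonical_null_frame k y Y : canonical_lift B k y Y -> null_frame B (cdom k) eu ev Y.
Proof.
move=> [[sY lY] cY]; split=> // z kz; first by have [] := lY z kz.
- by have [] := cY z kz; rewrite duE.
- by have [] := cY z kz; rewrite dvE.
- by have [] := cY z kz; rewrite duE dvE.
Qed.

Lemma null_frame_canonical k y Y : Defs.lift B k y Y -> null_frame B (cdom k) eu ev Y ->
  canonical_lift B k y Y.
Proof.
by move=> lY hY; split=> // z kz; rewrite duE dvE; split;
  [exact: nf_aa hY _ kz|exact: nf_bb hY _ kz|exact: nf_ab hY _ kz].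
Qed.

(** Pairing with a vector orthogonal to [Y] sees only the Hopf differentials. *)
Lemma adapted_second eps k y Y z x : eps * eps = 1 -> adapted B eps k y Y -> cdom k z ->
  B x (Y z) = 0 -> B x (pd ev (pd ev Y) z) = eps * B x (pd eu (pd eu Y) z).
Proof.
move=> eps2 [_ aY] kz x0; have [k1 [k2 [[_ _ [s1 e1] [s2 e2]] e12]]] := aY z kz.
move: e1 e2; rewrite !duE !dvE => -> ->.
by rewrite e12 !ipE x0 !mulr0 !add0r mulrA eps2 mul1r.
Qed.

Lemma flip_eu (e : R) : flip e eu = eu.
Proof. by rewrite /flip/= mulr0. Qed.

Lemma flip_ev (e : R) : flip e ev = e *: ev.
Proof. by apply: injective_projections => /=; rewrite /GRing.scale/= ?mulr0 ?mulr1. Qed.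

Section FlipLift.
Variables (k : chart R M) (D : set (R * R)) (e : R).
Hypotheses (oD : open D) (Dk : D `<=` cdom k) (ee : e * e = 1).
Local Notation kf := (flip_chart oD Dk ee).

Lemma smooth_flip_comp (F : normedModType R) (f : R * R -> F) :
  smooth D f -> smooth (cdom kf) (f \o flip e).
Proof.
move=> sf; have o : open (cdom kf) by exact: cdom_open.
by apply: (smooth_comp o _ _ sf) => //; exact: smooth_flip.
Qed.

Lemma flip_null_frame Y : null_frame B D eu (e *: ev) Y ->
  null_frame B (cdom kf) eu ev (Y \o flip e).
Proof.
case=> sY n0 na nb nab; split; first exact: smooth_flip_comp.
- by move=> z kz; exact: n0.
- by move=> z kz; rewrite pd_flip flip_eu; exact: na.
- by move=> z kz; rewrite pd_flip flip_ev; exact: nb.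
- by move=> z kz; rewrite !pd_flip flip_eu flip_ev; exact: nab.
Qed.

Lemma flip_lift y Y : smooth D Y ->
  (forall z, D z -> [/\ Y z <> 0, B (Y z) (Y z) = 0 & y (cpar k z) = proj_pt (Y z)]) ->
  Defs.lift B kf y (Y \o flip e).
Proof. by move=> sY lY; split=> [|z kz]; [exact: smooth_flip_comp|exact: lY]. Qed.

Lemma flip_polar_at Y s z : polar_at B eu (e *: ev) Y s (flip e z) ->
  polar_at B eu ev (Y \o flip e) (s \o flip e) z.
Proof. by case=> p0 pa pb da db; split; rewrite ?pd_flip ?flip_eu ?flip_ev. Qed.

Lemma flip_chart_at p z : atlas k -> D z -> cpar k z = p -> chart_at p kf.
Proof.
move=> ak Dz pz; split; first exact: flip_chart_atlas.
by exists (flip e z); rewrite /= flipK.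
Qed.
End FlipLift.
End Lifts.

Section Data.
Variables (R : realType) (V : normedModType R) (B : V -> V -> R).
Hypothesis hB : inner_product B.
Let ipE := (ipDl hB, ipDr hB, ipNl hB, ipNr hB, ipZl hB, ipZr hB).
Variables (M : smooth_surface R) (eps : R).
Hypothesis eps2 : eps * eps = 1.
Variables (y yh : M -> set V) (c : R) (psi : M -> V).
Hypothesis hyh : darboux_on B eps [set: M] y yh.
Hypothesis hpsi : c_polar B c y psi.
Hypothesis hnd : forall p, polar_immersed_at c psi p.
Implicit Types (k : chart R M) (Y Yh : R * R -> V).
Local Notation eu := ((1, 0) : R * R).
Local Notation ev := ((0, 1) : R * R).

(** A chart in which the local theory applies, with lifts of the surface and of its
Darboux transform. *)
Record darboux_chart k Y Yh : Prop := DarbouxChart {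
  dc_atlas : atlas k;
  dc_lift : Defs.lift B k y Y;
  dc_hat_lift : Defs.lift B k yh Yh;
  dc_pair : polar_pair B (cdom k) eps eu ev Y Yh (psi \o cpar k)
}.

Lemma psi_smooth k : atlas k -> smooth (cdom k) (psi \o cpar k).
Proof. by move=> ak; case: hpsi => s _ _ _; exact: s. Qed.

Lemma psi_norm p : B (psi p) (psi p) = c.
Proof. by case: hpsi. Qed.

Lemma psi_polar_at k Y z : atlas k -> Defs.lift B k y Y -> null_frame B (cdom k) eu ev Y ->
  cdom k z -> polar_at B eu ev Y (psi \o cpar k) z.
Proof.
move=> ak lY hY kz; case: hpsi => _ _ _ /(_ (cpar k z))[k1 [[ak1 [z1 kz1 e1]] [Y1 [cY1 n1]]]].
have hY1 := canonical_null_frame cY1.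
apply: (polar_at_change hB ak1 ak kz1 kz e1 cY1.1 lY hY1 hY (psi_smooth ak1)).
exact: (parallel_polar_at hB (@cdom_open _ _ k1) hY1 (psi_smooth ak1) n1 kz1).
Qed.

Lemma psi_polar_section k Y : atlas k -> adapted B eps k y Y ->
  polar_section B (cdom k) eps eu ev Y (psi \o cpar k).
Proof.
move=> ak aY; have lY := aY.1.1; have hY := canonical_null_frame aY.1.
have pz z (kz : cdom k z) := psi_polar_at ak lY hY kz.
split; first exact: psi_smooth.
- by move=> z /pz[].
- by move=> z /pz[].
- by move=> z /pz[].
- by move=> z /pz[].
- by move=> z /pz[].
- by move=> z kz; apply: (adapted_second hB eps2 aY kz); have [] := pz z kz.
Qed.

(** Division by <Y, Yh> changes the derivatives of [Yh] only by multiples of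
[Yh]. *)
Lemma normalized_partner k Y Yh : Defs.lift B k y Y -> Defs.lift B k yh Yh ->
  (forall z, cdom k z -> [/\ B (Y z) (Yh z) <> 0,
     lin_span [:: Yh z; Y z; dv Y z] (du Yh z) & lin_span [:: Yh z; Y z; du Y z] (dv Yh z)]) ->
  let Yn := fun z => (B (Y z) (Yh z))^-1 *: Yh z in
  Defs.lift B k yh Yn /\ darboux_partner B (cdom k) eu ev Y Yn.
Proof.
move=> lY lYh h /=; have oU : open (cdom k) by exact: cdom_open.
have g0 z : cdom k z -> B (Y z) (Yh z) != 0 by move=> /h[/eqP].
have sg := smooth_ip hB oU lY.1 lYh.1; have sV := smoothV oU g0 sg.
have V0 z : cdom k z -> (B (Y z) (Yh z))^-1 != 0 by move=> kz; rewrite invr_neq0 ?g0.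
have lYn := lift_scale hB lYh sV V0; split=> //.
have dY d z : cdom k z -> pd d (fun z => (B (Y z) (Yh z))^-1 *: Yh z) z = _ :=
  fun kz => pd_scale d sV lYh.1 kz.
split; first exact: lYn.1.
- by move=> z kz; have [] := lYn.2 z kz.
- by move=> z kz; rewrite (ipZr hB) mulVf// g0.
- move=> z kz; have [_ /lin_span3[a [b [d +]]] _] := h z kz; rewrite duE dvE dY// => ->.
  set i := pd eu _ z; set g := B (Y z) (Yh z).
  exists (i * g + a), (g^-1 * b), (g^-1 * d).
  by apply: (ip_ext hB) => w; rewrite !ipE; field; exact: g0.
- move=> z kz; have [_ _ /lin_span3[a [b [d]]]] := h z kz; rewrite duE dvE dY// => ->.
  set i := pd ev _ z; set g := B (Y z) (Yh z).
  exists (i * g + a), (g^-1 * b), (g^-1 * d).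
  by apply: (ip_ext hB) => w; rewrite !ipE; field; exact: g0.
Qed.

(** If the Hopf heights vanish at a point, both derivatives of [psi] are multiples
of [Y] there, so some direction is in the kernel of the differential. *)
Lemma psi_hopf_neq0 k Y z : atlas k -> adapted B eps k y Y -> cdom k z ->
  hopf_height B eu Y (psi \o cpar k) z != 0.
Proof.
move=> ak aY kz; apply/eqP => m0.
have oU : open (cdom k) by exact: cdom_open.
have hY := canonical_null_frame aY.1; have hp := psi_polar_section ak aY.
have hY' := null_frame_sym hB hY; have hp' := polar_section_sym eps2 hp.
have su := pd_polar hB oU hY hp kz; have sv := pd_polar hB oU hY' hp' kz.
rewrite m0 mulr0 scale0r subr0 in su.
rewrite (hopf_height_sym hB oU eps2 hY hp kz) m0 !mulr0 scale0r subr0 in sv.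
set r := 2 * _ in su; set t := 2 * _ in sv.
have D (a : R * R) : pd a (psi \o cpar k) z = (a.1 * r + a.2 * t) *: Y z.
  by rewrite (pd_plane a (psi_smooth ak) kz) su sv !scalerA -scalerDl.
have im (a : R * R) : a.1 * r + a.2 * t = 0 -> a = 0.
  move=> h; apply: (hnd ak kz (erefl _)).
  have -> : 'D_a (psi \o cpar k) z = 0 by have := D a; rewrite pdE h scale0r.
  by case: ifP => _ //=; exists 0 => //; rewrite scale0r.
have [t0|/eqP t0] := eqVneq t 0.
  by have := im ev; rewrite /= mul0r add0r mul1r => /(_ t0)[] /eqP; rewrite oner_eq0.
have /im[t0' _] : (t, - r).1 * r + (t, - r).2 * t = 0 by rewrite /=; ring.
by rewrite t0' in t0.
Qed.

Lemma darboux_chart_at p : exists k Y Yh, chart_at p k /\ darboux_chart k Y Yh.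
Proof.
case: hyh => _ tl /(_ p I)[k [[ak pk] [Y [Yh [aY lYh h]]]]].
have oU : open (cdom k) by exact: cdom_open.
have lY := aY.1.1; have hY := canonical_null_frame aY.1.
have [lYn hd] := normalized_partner lY lYh h.
have hp := psi_polar_section ak aY.
exists k, Y, (fun z => (B (Y z) (Yh z))^-1 *: Yh z); split=> //; split=> //; split=> // z kz.
  exact: psi_hopf_neq0.
have [k1 [[ak1 [z1 kz1 e1]] [F1 [lF1 lor]]]] := tl (cpar k z) I.
have hY' := null_frame_sym hB hY; have hd' := darboux_partner_sym hd.
have := timelike_change hB ak1 ak kz1 kz e1 lF1 lYn (lor _ kz1)
  (pd_partner_norm hB oU hY hd kz) (pd_partner_norm hB oU hY' hd' kz).
rewrite (pd_partner_cross hB oU hY hd kz); apply: contra => /eqP ->.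
by rewrite !mul0r.
Qed.

(** A value is chosen at each point from some Darboux chart;
[polar_hat_change] says that every other Darboux chart gives the same one. *)
Lemma exists_polar_hat : exists psih : M -> V, forall k Y Yh z, darboux_chart k Y Yh ->
  cdom k z -> psih (cpar k z) = polar_hat B eu Y Yh (psi \o cpar k) z.
Proof.
have ex p : exists x, exists k Y Yh z, [/\ darboux_chart k Y Yh, cdom k z, cpar k z = p &
    x = polar_hat B eu Y Yh (psi \o cpar k) z].
  have [k [Y [Yh [[ak [z kz e]] dc]]]] := darboux_chart_at p.
  by exists (polar_hat B eu Y Yh (psi \o cpar k) z), k, Y, Yh, z.
have [psih hpsih] := choice ex.
exists psih => k Y Yh z dc kz.
have [k1 [Y1 [Yh1 [z1 [dc1 kz1 e1 ->]]]]] := hpsih (cpar k z).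
exact: (polar_hat_change hB eps2 (dc_atlas dc1) (dc_atlas dc) kz1 kz e1 (dc_lift dc1) (dc_lift dc)
  (dc_hat_lift dc1) (dc_hat_lift dc) (dc_pair dc1) (dc_pair dc)).
Qed.
End Data.

(** * The polar surface of the Darboux transform, globally *)

Lemma rank_le1_kernel (R : realType) (F : normedModType R) (U : set (R * R)) (f : R * R -> F)
    z x (r t : R) : smooth U f -> U z ->
  pd (1, 0) f z = r *: x -> pd (0, 1) f z = t *: x ->
  exists2 a : R * R, a <> 0 & 'D_a f z = 0.
Proof.
move=> sf Uz su sv.
have D (a : R * R) : 'D_a f z = (a.1 * r + a.2 * t) *: x.
  have -> : 'D_a f z = pd a f z by rewrite pdE.
  by rewrite (pd_plane a sf Uz) su sv !scalerA -scalerDl.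
have [t0|/eqP t0] := eqVneq t 0.
  exists (0, 1); first by case=> /eqP; rewrite oner_eq0.
  by rewrite D t0 /= mul0r mulr0 addr0 scale0r.
exists (t, - r); first by case.
by rewrite D /= (_ : _ + _ = 0) ?scale0r//; ring.
Qed.

Section HatSurface.
Variables (R : realType) (V : normedModType R) (B : V -> V -> R).
Hypothesis hB : inner_product B.
Let ipE := (ipDl hB, ipDr hB, ipNl hB, ipNr hB, ipZl hB, ipZr hB).
Variables (M : smooth_surface R) (eps : R).
Hypothesis eps2 : eps * eps = 1.
Variables (y yh : M -> set V) (c : R) (psi psih : M -> V).
Hypothesis hyh : darboux_on B eps [set: M] y yh.
Hypothesis hpsi : c_polar B c y psi.
Hypothesis hnd : forall p, polar_immersed_at c psi p.
Local Notation eu := ((1, 0) : R * R).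
Local Notation ev := ((0, 1) : R * R).
Local Notation dchart := (darboux_chart B eps y yh psi).
Hypothesis hatE : forall k Y Yh z, dchart k Y Yh -> cdom k z ->
  psih (cpar k z) = polar_hat B eu Y Yh (psi \o cpar k) z.

Section OneChart.
Variables (k : chart R M) (Y Yh : R * R -> V).
Hypothesis dc : dchart k Y Yh.
Let P := dc_pair dc.
Let P' := polar_pair_sym hB (@cdom_open _ _ k) eps2 P.
Let oU : open (cdom k) := @cdom_open _ _ k.
Let hd := pp_partner P.
Let hY := pp_frame P.
Let hY' := null_frame_sym hB hY.
Let hd' := darboux_partner_sym hd.
Local Notation h := (polar_hat B eu Y Yh (psi \o cpar k)).

Lemma smooth_hat : smooth (cdom k) (psih \o cpar k).
Proof.
apply: (smooth_eq_on oU _ (smooth_polar_hat hB oU P)) => z kz.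
by rewrite -(hatE dc kz).
Qed.

Lemma pd_hat a z : cdom k z -> pd a (psih \o cpar k) z = pd a h z.
Proof. by move=> kz; apply: (pd_eq_on a oU _ kz) => x kx; exact: hatE dc kx. Qed.

Lemma pd_hat_v z : cdom k z -> pd ev h z = pd ev (polar_hat B ev Y Yh (psi \o cpar k)) z.
Proof.
move=> kz; apply: (pd_eq_on ev oU _ kz) => x kx.
by rewrite (polar_hat_sym hB oU eps2 P kx).
Qed.

Lemma ip_d_hat d z : cdom k z -> B (pd d Yh z) (Yh z) = 0.
Proof.
by move=> kz; rewrite (ip_sym hB); exact: (null_cst_self hB oU d (dp_smooth hd) (dp_hh hd) kz).
Qed.

(** Up to multiples of [Yh], the derivatives of the new surface are those of [Yh],
exchanged, times - <psi, Yh> and a nonzero factor.  Where <psi, Yh> = 0 they are dependent;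
elsewhere pairing with the derivatives of [Yh], to which the surface is
orthogonal, shows that no direction is in the kernel. *)
Lemma hat_immersed z : cdom k z ->
  polar_immersed_at c psih (cpar k z) <-> B (psi (cpar k z)) (Yh z) <> 0.
Proof.
move=> kz.
have [t et] := pd_polar_hat_parallel hB oU eps2 P kz.
have [t' et'] := pd_polar_hat_parallel hB oU eps2 P' kz.
rewrite -pd_hat_v// in et'; rewrite /= in et et'.
have g0 := pp_coeff P kz; have g0' := pp_coeff P' kz.
split=> [im f0|/eqP f0].
  have su : pd eu (psih \o cpar k) z = t *: Yh z.
    by rewrite pd_hat// et f0 oppr0 mul0r scale0r add0r.
  have sv : pd ev (psih \o cpar k) z = t' *: Yh z.
    by rewrite pd_hat// et' f0 oppr0 mul0r scale0r add0r.
  have [a a0 Da] := rank_le1_kernel smooth_hat kz su sv; apply: a0.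
  apply: (im k z (dc_atlas dc) kz (erefl _)); rewrite Da.
  by case: ifP => _ //=; exists 0 => //; rewrite scale0r.
move=> k2 z2 ak2 kz2 e12 a Ca.
apply: (@immersed_chart _ _ _ _ _ _ _ (dc_atlas dc) ak2 kz kz2 (esym e12) c psih smooth_hat); last first.
  by rewrite pdE.
move=> b Cb.
have key d : B (h z) (pd d Yh z) = 0 -> B (pd b h z) (pd d Yh z) = 0.
  rewrite -pd_hat// -(hatE dc kz) => hd0; move: Cb; case: ifP => _.
    by case=> s _ <-; rewrite ipE hd0 mulr0.
  by move=> ->; rewrite (ip0l hB).
have ku := key _ (polar_hat_hd hB oU P kz).
have kv : B (pd b h z) (pd ev Yh z) = 0.
  by apply: key; rewrite -(polar_hat_sym hB oU eps2 P kz) (polar_hat_hd hB oU P' kz).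
have sh := smooth_polar_hat hB oU P.
move: ku kv; rewrite (pd_plane b sh kz) et et' !ipE.
rewrite !(ip_sym hB (Yh z)) !ip_d_hat// (pd_partner_norm hB oU hY hd)// (pd_partner_norm hB oU hY' hd')//.
rewrite (ip_sym hB (pd ev Yh z)) (pd_partner_cross hB oU hY hd)// => ku kv.
have scal (x w F g g' t1 t2 t3 : R) : F != 0 -> g != 0 -> g' != 0 ->
    x * (- F / g' * (g * g' / 2) + t1 * 0) + w * (t2 * 0 + t3 * 0) = 0 -> x = 0.
  move=> F0 gn gn' E; have : x * (F * g) = -2 * 0 by rewrite -E; field.
  by rewrite mulr0 => /eqP; rewrite !mulf_eq0 (negPf F0) (negPf gn) !orbF => /eqP.
apply: injective_projections => /=; first exact: scal ku.
by apply: scal f0 g0' g0 _; rewrite [X in X / 2]mulrC addrC; exact: kv.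
Qed.

Lemma orth_hat z : cdom k z ->
  orth B (yh (cpar k z)) (psi (cpar k z)) <-> B (psi (cpar k z)) (Yh z) = 0.
Proof.
move=> kz; have [_ _ ->] := (dc_hat_lift dc).2 z kz; split=> [horth|f0 _ [s _ <-]].
  by apply: horth; exists 1 => //; rewrite scale1r.
by rewrite ipE f0 mulr0.
Qed.

(** The canonical lift is Yh / g in the coordinates (u, eps v): since g is
constant its derivatives are those of [Yh] over g, and their product is
eps g (eps g) / (2 g^2) = 1/2. *)
Lemma hat_polar_chart p : (cpar k @` cdom k) p -> exists k, chart_at p k /\ exists Y,
    canonical_lift B k yh Y /\
    forall z, cdom k z ->
      [/\ normal B Y z (psih (cpar k z)),
          normal_part B Y z (du (psih \o cpar k) z) 0 &
          normal_part B Y z (dv (psih \o cpar k) z) 0].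
Proof.
move=> [z kz ez].
have sub : cdom k `<=` cdom k by [].
pose g x := darboux_coeff B eu Y Yh x.
have g0 x : cdom k x -> g x != 0 by move=> kx; have := pp_coeff P kx.
have sg : smooth (cdom k) g by apply: (smooth_darboux_coeff hB oU eu (nf_smooth hY) (dp_smooth hd)).
have sV := smoothV oU g0 sg.
have V0 x : cdom k x -> (g x)^-1 != 0 by move=> kx; rewrite invr_neq0 ?g0.
have lC := lift_scale hB (dc_hat_lift dc) sV V0.
(* The canonical lift, in the coordinates (u, v); the reflection comes last. *)
pose C x := (g x)^-1 *: Yh x.
have sC : smooth (cdom k) C by exact: lC.1.
have dg d x : cdom k x -> pd d g x = 0 -> pd d C x = (g x)^-1 *: pd d Yh x.
  move=> kx dg0; rewrite (pd_scale d sV (dp_smooth hd) kx).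
  have := pd_eq_on d oU (fun x kx => mulVf (g0 x kx)) kx.
  rewrite (pd_mul d sV sg kx) pd_cst dg0 mulr0 addr0 => /eqP.
  by rewrite mulf_eq0 (negPf (g0 x kx)) orbF => /eqP ->; rewrite scale0r add0r.
have Cu x (kx : cdom k x) := dg eu x kx (pd_darboux_coeff_self hB oU eps2 P kx).
have Cv x (kx : cdom k x) := dg ev x kx (pd_darboux_coeff hB oU hY' hd' kx).
have Cev x : cdom k x -> pd (eps *: ev) C x = eps *: ((g x)^-1 *: pd ev Yh x).
  by move=> kx; rewrite (pd_dirZ eps ev sC kx) Cv.
have frame : null_frame B (cdom k) eu (eps *: ev) C.
  split=> // x kx.
  - by have [] := lC.2 x kx.
  - by rewrite Cu// !ipE (pd_partner_norm hB oU hY hd)// !mulr0.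
  - by rewrite Cev// !ipE (pd_partner_norm hB oU hY' hd')// !mulr0.
  - rewrite Cu// Cev// !ipE (pd_partner_cross hB oU hY hd)// (polar_pair_coeff hB oU eps2 P kx).
    rewrite -/(g x); have gx0 := g0 x kx.
    transitivity (eps * eps / 2); first by field.
    by rewrite eps2 mul1r.
have polar x : cdom k x -> polar_at B eu (eps *: ev) C h x.
  move=> kx; have gx0 := g0 x kx; have gx0' := pp_coeff P' kx; have e0 := eps_neq0 eps2.
  have sh := smooth_polar_hat hB oU P.
  split.
  - by rewrite (ipZr hB) (polar_hat_h hB P)// mulr0.
  - by rewrite Cu// (ipZr hB) (polar_hat_hd hB oU P)// mulr0.
  - rewrite Cev// !(ipZr hB) -(polar_hat_sym hB oU eps2 P kx) (polar_hat_hd hB oU P' kx).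
    by rewrite !mulr0.
  - have [t ->] := pd_polar_hat_parallel hB oU eps2 P kx.
    set r := _ / _; exists (t * g x), (r * g x * eps); rewrite Cev// /C.
    apply: (ip_ext hB) => w; rewrite !ipE.
    transitivity ((eps * eps) * (r * B (pd ev Yh x) w) + t * B (Yh x) w); last by field.
    by rewrite eps2 mul1r.
  - rewrite (pd_dirZ eps ev sh kx) pd_hat_v//.
    have [t ->] := pd_polar_hat_parallel hB oU eps2 P' kx.
    set r := _ / _; exists (eps * t * g x), (eps * r * g x); rewrite Cu// /C.
    by apply: (ip_ext hB) => w; rewrite !ipE; field.
exists (flip_chart oU sub eps2); split; first exact: (flip_chart_at oU sub eps2 (dc_atlas dc) kz ez).
exists (C \o flip eps).
have lf := flip_lift oU sub eps2 sC lC.2.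
have oF : open (cdom (flip_chart oU sub eps2)) by exact: cdom_open.
split.
  apply: null_frame_canonical => //; exact: flip_null_frame.
move=> x kx; apply: (polar_at_parallel hB oF) => //.
- exact: flip_null_frame.
- exact: (smooth_flip_comp oU sub eps2 smooth_hat).
move=> x' kx'; apply: (@flip_polar_at _ _ _ eps C (psih \o cpar k)).
have [p0 pa pb da db] := polar _ kx'.
by split; rewrite ?pd_hat// /= (hatE dc).
Qed.
End OneChart.
End HatSurface.

Section Conclusion.
Variables (R : realType) (V : normedModType R) (B : V -> V -> R).
Hypothesis hB : inner_product B.
Variables (M : smooth_surface R) (eps : R).
Hypothesis eps2 : eps * eps = 1.
Variables (y yh : M -> set V) (c : R) (psi psih : M -> V).
Hypothesis hyh : darboux_on B eps [set: M] y yh.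
Hypothesis hpsi : c_polar B c y psi.
Hypothesis hnd : forall p, polar_immersed_at c psi p.
Local Notation eu := ((1, 0) : R * R).
Local Notation ev := ((0, 1) : R * R).
Local Notation dchart := (darboux_chart B eps y yh psi).
Hypothesis hatE : forall k Y Yh z, dchart k Y Yh -> cdom k z ->
  psih (cpar k z) = polar_hat B eu Y Yh (psi \o cpar k) z.

Let dchart_at := darboux_chart_at hB eps2 hyh hpsi hnd.

Lemma hat_smooth_map : smooth_map psih.
Proof.
move=> k ak; apply: smooth_local => z kz.
have [k1 [Y [Yh [[ak1 [z1 kz1 e1]] dc]]]] := dchart_at (cpar k z).
exists (overlap k k1); first exact: (overlap_pt kz1 kz e1).
exact: (smooth_chart_change ak1 ak (smooth_hat hB hatE dc)).
Qed.

Lemma hat_norm p : B (psih p) (psih p) = c.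
Proof.
have [k [Y [Yh [[ak [z kz <-]] dc]]]] := dchart_at p.
by rewrite (hatE dc kz) (polar_hat_norm hB (dc_pair dc) kz) (psi_norm hpsi).
Qed.

Lemma hat_neq0 p : psih p <> 0.
Proof.
have [k [Y [Yh [[ak [z kz <-]] dc]]]] := dchart_at p.
rewrite (hatE dc kz) => h0.
have := hat_height_neq0 (dc_pair dc) kz.
by rewrite -(polar_hat_0 hB (dc_pair dc) kz) h0 (ip0l hB) eqxx.
Qed.

Lemma hat_c_polar : c_polar B c yh psih.
Proof.
split; first exact: hat_smooth_map.
- exact: hat_norm.
- by move=> _; exact: hat_neq0.
move=> p; have [k [Y [Yh [[ak pk] dc]]]] := dchart_at p.
exact: (hat_polar_chart hB eps2 hatE dc pk).
Qed.

Lemma hat_immersed_orth p : polar_immersed_at c psih p <-> ~ orth B (yh p) (psi p).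
Proof.
have [k [Y [Yh [[ak [z kz <-]] dc]]]] := dchart_at p.
have H1 := hat_immersed hB eps2 c hatE dc kz; have H2 := orth_hat hB dc kz.
by split=> [/H1 h /H2//|h]; apply/H1 => f0; apply: h; apply/H2.
Qed.

Section ModelDarboux.
Variables (V' : normedModType R) (B' : V' -> V' -> R).
Hypothesis hB' : inner_product B'.
Variables (J : {linear V -> V'}) (e0 : V').
Hypothesis cJ : continuous J.
Hypothesis JJ : forall x x', B' (J x) (J x') = B x x'.
Hypothesis Je : forall x, B' (J x) e0 = 0.
Hypothesis ee : B' e0 e0 = - c.
Hypothesis psi0 : forall p, model_point J e0 (psi p) <> 0.
Hypothesis psih0 : forall p, model_point J e0 (psih p) <> 0.

Let W := [set p | polar_immersed_at c psih p].
Let yP p := proj_pt (model_point J e0 (psi p)).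
Let yH p := proj_pt (model_point J e0 (psih p)).

(** The chart is restricted to the points where <psi, Yh> <> 0.  There the
surfaces are not orthogonal, and the metric of the new one, which has
<H_u, H_v> = eps <psi, Yh>^2 / 2, is nondegenerate. *)
Lemma model_chart p : W p -> exists k, chart_at p k /\ exists Z H,
  [/\ adapted B' eps k yP Z, Defs.lift B' k yH H &
  forall z, cdom k z ->
  [/\ B' (Z z) (H z) <> 0,
      lin_span [:: H z; Z z; dv Z z] (du H z),
      lin_span [:: H z; Z z; du Z z] (dv H z),
      lorentzian (fun a b => B' ('D_a Z z) ('D_b Z z)) &
      lorentzian (fun a b => B' ('D_a H z) ('D_b H z))]].
Proof.
move=> Wp; have [k [Y [Yh [[ak [z0 kz0 pz0]] dc]]]] := dchart_at p.
have P := dc_pair dc; have oU : open (cdom k) by exact: cdom_open.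
pose s := psi \o cpar k; pose f z := B (s z) (Yh z).
have sf : smooth (cdom k) f.
  exact: (smooth_ip hB oU (ps_smooth (pp_polar P)) (dp_smooth (pp_partner P))).
pose D := cdom k `&` [set z | f z != 0].
have oD : open D := smooth_open_neq0 oU sf.
have Dk : D `<=` cdom k by move=> z [].
have Dz0 : D z0.
  by split=> //=; apply/eqP/(hat_immersed hB eps2 c hatE dc kz0); rewrite pz0.
have sc z : cdom k z -> B (s z) (s z) = c by move=> _; exact: (psi_norm hpsi).
(* Z and H are the lifts in the coordinates (u, v) of k; the chart kf below reflects them. *)
pose Z := model_lift B J e0 eu Y s; pose H z := model_point J e0 (psih (cpar k z)).
pose h := polar_hat B eu Y Yh s.
have Hh z : cdom k z -> model_point J e0 (h z) = H z by move=> kz; rewrite /H (hatE dc kz).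
have sH : smooth (cdom k) H.
  by apply: (smooth_eq_on oU Hh); exact: (smooth_model_hat hB e0 cJ oU P).
have dH a z : cdom k z -> pd a H z = pd a (fun x => model_point J e0 (h x)) z.
  by move=> kz; apply: (pd_eq_on a oU _ kz) => x kx; rewrite Hh.
have fZ := model_null_frame hB hB' cJ JJ Je ee oU eps2 P sc.
have sZ := nf_smooth fZ.
have nfD : null_frame B' D eu (eps *: ev) Z.
  split; first exact: smooth_sub sZ.
  - by move=> z /Dk; exact: nf_00 fZ _.
  - by move=> z /Dk; exact: nf_aa fZ _.
  - by move=> z /Dk; exact: nf_bb fZ _.
  - by move=> z /Dk; exact: nf_ab fZ _.
pose kf := flip_chart oD Dk eps2.
have oF : open (cdom kf) by exact: cdom_open.
have N0 z : cdom k z -> model_scale B eu Y s z != 0 by move=> kz; exact: (model_scale_neq0 P kz).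
have lZ : Defs.lift B' kf yP (Z \o flip eps).
  apply: flip_lift; first exact: smooth_sub sZ.
  move=> z /Dk kz; split; last by rewrite /yP proj_ptZ ?N0.
    by apply/eqP; rewrite scaler_eq0 negb_or N0//=; apply/eqP; exact: psi0.
  exact: nf_00 fZ _ kz.
have fF := flip_null_frame oD Dk eps2 nfD.
have cZ := null_frame_canonical lZ fF.
have lH : Defs.lift B' kf yH (H \o flip eps).
  apply: flip_lift; first exact: smooth_sub sH.
  move=> z /Dk kz; split=> //; first exact: psih0.
  by rewrite -Hh// (model_hat_null hB hB' JJ Je ee P sc kz).
exists kf; split; first exact: (flip_chart_at oD Dk eps2 ak Dz0 pz0).
exists (Z \o flip eps), (H \o flip eps).
have flipE a (F : R * R -> V') : pd a (F \o flip eps) = pd (flip eps a) F \o flip eps.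
  by apply/funext => z; rewrite pd_flip.
split=> //.
  split=> // z kz; apply: (null_frame_hopf hB' oF fF) => //.
  rewrite !flipE flip_eu flip_ev.
  exact: (model_isothermic hB hB' e0 cJ oU eps2 P (Dk _ kz)).
move=> z kz; have kw : cdom k (flip eps z) by exact: (Dk _ kz).
have fw : f (flip eps z) != 0 by case: kz.
have [Su Sv] := pd_model_hat_span hB hB' e0 cJ oU eps2 P kw.
have [m1 m2 m3] := model_hat_metric hB hB' e0 cJ JJ oU eps2 P kw.
rewrite -!dH// in Su Sv m1 m2 m3; rewrite Hh// in Su Sv.
rewrite !duE !dvE !flipE flip_eu flip_ev /=; split.
- apply/eqP; rewrite -Hh// (model_hat_cross hB hB' JJ Je ee P sc kw).
  exact: (mulf_neq0 (mulf_neq0 (N0 _ kw) (hat_height_neq0 P kw)) fw).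
- by apply/lin_span3.
- by apply/lin_span3.
- apply: (null_lorentzian hB' (nf_smooth fF) kz); [exact: nf_aa fF _ kz|exact: nf_bb fF _ kz|].
  by rewrite (nf_ab fF kz) invr_neq0// pnatr_eq0.
- apply: (null_lorentzian hB' lH.1 kz); rewrite !flipE ?flip_eu ?flip_ev //=.
  rewrite m3 !mulf_neq0 ?(eps_neq0 eps2) ?invr_neq0 ?pnatr_eq0//.
Qed.

Lemma model_darboux : darboux_on B' eps W yP yH.
Proof.
split.
- split=> p /model_chart[k [pk [Z [H [aZ lH h]]]]]; exists k; split=> //; exists Z => //.
  by split=> [|z /h[]//]; exact: aZ.1.1.
- move=> p /model_chart[k [pk [Z [H [aZ lH h]]]]]; exists k; split=> //; exists H.
  by split=> // z /h[].
- move=> p /model_chart[k [pk [Z [H [aZ lH h]]]]]; exists k; split=> //; exists Z, H.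
  by split=> // z /h[].
Qed.
End ModelDarboux.
End Conclusion.

(** * The inner product spaces of the theorem *)

Section Spaces.
Variable R : realType.

Lemma sum_mul_delta (m : nat) (P : pred 'I_m) (x : 'rV[R]_m) j :
  \sum_(i < m | P i) x 0 i * (delta_mx 0 j : 'rV[R]_m) 0 i = if P j then x 0 j else 0.
Proof.
rewrite big_mkcond (bigD1 j)//= big1 ?addr0; first by rewrite mxE !eqxx mulr1.
by move=> i ij; rewrite mxE eqxx (negPf ij) mulr0; case: ifP.
Qed.

Lemma pseudo_euclid_inner_product (m s : nat) : inner_product (@pseudo_euclid R m.+1 s).
Proof.
split.
- by move=> x y; congr (_ - _); apply: eq_bigr => i _; rewrite mulrC.
- move=> y a x x'; rewrite /pseudo_euclid mulrBr !mulr_sumr addrACA -opprD -!big_split/=.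
  by congr (_ - _); apply: eq_bigr => i _; rewrite !mxE; ring.
- have c1 (i : 'I_m.+1) : continuous (fun p : 'rV[R]_m.+1 * 'rV[R]_m.+1 => p.1 0 i).
    move=> p; apply: (continuous_comp (f := fst) (g := fun x : 'rV[R]_m.+1 => x 0 i)).
      exact: cvg_fst.
    exact: coord_continuous.
  have c2 (i : 'I_m.+1) : continuous (fun p : 'rV[R]_m.+1 * 'rV[R]_m.+1 => p.2 0 i).
    move=> p; apply: (continuous_comp (f := snd) (g := fun x : 'rV[R]_m.+1 => x 0 i)).
      exact: cvg_snd.
    exact: coord_continuous.
  move=> p; apply: cvgB.
    apply: cvg_big => [|i _]; [exact: add_continuous|apply: cvgM; [exact: c1|exact: c2]].
  apply: cvg_big => [|i _]; [exact: add_continuous|apply: cvgM; [exact: c1|exact: c2]].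
- move=> x hx; apply/rowP => j; rewrite mxE.
  have := hx (delta_mx 0 j); rewrite /pseudo_euclid !sum_mul_delta.
  by case: ltnP => _ /=; [rewrite subr0|rewrite sub0r => /eqP; rewrite oppr_eq0 => /eqP].
Qed.

Lemma ext_inner_product (V : normedModType R) (B : V -> V -> R) (c : R) :
  inner_product B -> c != 0 -> inner_product (ext_form B c).
Proof.
move=> hB c0; split.
- by move=> x y; rewrite /ext_form (ip_sym hB); ring.
- by move=> y a x x'; rewrite /ext_form /= (ipDl hB) (ipZl hB) /GRing.scale /=; ring.
- move=> p.
  have c1 : (fun p : (V * R^o) * (V * R^o) => p.1.1) @ p --> p.1.1.
    by apply: (continuous_comp (f := fst) (g := fst)); exact: cvg_fst.
  have c2 : (fun p : (V * R^o) * (V * R^o) => p.2.1) @ p --> p.2.1.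
    by apply: (continuous_comp (f := snd) (g := fst)); [exact: cvg_snd|exact: cvg_fst].
  have c3 : (fun p : (V * R^o) * (V * R^o) => p.1.2 : R) @ p --> (p.1.2 : R).
    by apply: (continuous_comp (f := fst) (g := snd)); [exact: cvg_fst|exact: cvg_snd].
  have c4 : (fun p : (V * R^o) * (V * R^o) => p.2.2 : R) @ p --> (p.2.2 : R).
    by apply: (continuous_comp (f := snd) (g := snd)); exact: cvg_snd.
  have c5 : (fun p : (V * R^o) * (V * R^o) => B p.1.1 p.2.1) @ p --> B p.1.1 p.2.1.
    exact: (cvg_comp2 c1 c2 (@ip_continuous _ _ _ hB (p.1.1, p.2.1))).
  by apply: cvgB => //; apply: cvgM => //; apply: cvgM => //; exact: cvg_cst.
- move=> x hx.
  have x1 : x.1 = 0.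
    apply: (ip_nondegenerate hB) => w; have := hx (w, 0).
    by rewrite /ext_form /= mulr0 subr0.
  have x2 : x.2 = 0.
    have := hx (0, 1); rewrite /ext_form /= (ip0r hB) mulr1 sub0r => /eqP.
    by rewrite oppr_eq0 mulf_eq0 (negPf c0) => /eqP.
  by apply: injective_projections.
Qed.

Definition base_point (V : normedModType R) (x : V) : V * R^o := (x, 0).

Lemma base_point_is_linear (V : normedModType R) : linear (@base_point V).
Proof. by move=> a x y; apply: injective_projections; rewrite /= ?scaler0 ?addr0. Qed.
HB.instance Definition _ (V : normedModType R) :=
  GRing.isLinear.Build R V (V * R^o)%type _ (@base_point V) (@base_point_is_linear V).

End Spaces.

Theorem theorem5p3 (R : realType) (n r : nat) (hr : (1 <= r)%N)
    (hnr : (2 <= n - r)%N) (M : smooth_surface R)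
    (eps : R) (heps : eps = 1 \/ eps = -1)
    (y yh : M -> set 'rV[R]_n.+2)
    (hyQ : forall p, Qnr r (y p)) (hyhQ : forall p, Qnr r (yh p))
    (hy : isothermic_on (@conf_form R n r) eps [set: M] y)
    (hyh : darboux_on (@conf_form R n r) eps [set: M] y yh)
    (c : R) (psi : M -> 'rV[R]_n.+2)
    (hpsi : c_polar (@conf_form R n r) c y psi)
    (hnd : forall p, polar_immersed_at c psi p) :
  exists psih : M -> 'rV[R]_n.+2,
    [/\ c_polar (@conf_form R n r) c yh psih,
        forall p, polar_immersed_at c psih p <->
                  ~ orth (@conf_form R n r) (yh p) (psi p) &
        polar_darboux_on (@conf_form R n r) eps c
          [set p | polar_immersed_at c psih p] psi psih].
Proof.
have eps2 : eps * eps = 1 by case: heps => ->; rewrite ?mulrNN mulr1.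
have hB : inner_product (@conf_form R n r) by exact: pseudo_euclid_inner_product.
have [psih hatE] := exists_polar_hat hB eps2 hyh hpsi hnd.
exists psih; split.
- exact: (hat_c_polar hB eps2 hyh hpsi hnd hatE).
- exact: (hat_immersed_orth hB eps2 hyh hpsi hnd hatE).
split=> [/eqP c0|c0].
- have hE := ext_inner_product hB c0.
  pose J : {linear 'rV[R]_n.+2 -> ('rV[R]_n.+2 * R^o)%type} := @base_point R 'rV[R]_n.+2.
  pose e0 : ('rV[R]_n.+2 * R^o)%type := (0, 1).
  have modelE x : model_point J e0 x = (x, 1).
    by rewrite /model_point /e0; congr pair; rewrite /= ?addr0 ?add0r.
  have nz x : model_point J e0 x <> 0 by rewrite modelE => -[_ /eqP]; rewrite oner_eq0.
  have cJ : continuous J.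
    move=> x.
    have c1 : (fun w : 'rV[R]_n.+2 => w) @ x --> x by move=> A hA.
    exact: (cvg_pair c1 (@cvg_cst R^o 0 _ (nbhs x) _)).
  have JJ x x' : ext_form (@conf_form R n r) c (J x) (J x') = conf_form r x x'.
    by rewrite /ext_form /= !mulr0 subr0.
  have Je x : ext_form (@conf_form R n r) c (J x) e0 = 0.
    by rewrite /ext_form /= (ip0r hB) mulr0 mul0r subr0.
  have ee : ext_form (@conf_form R n r) c e0 e0 = - c.
    by rewrite /ext_form /= (ip0r hB) !mulr1 sub0r.
  have := model_darboux hB eps2 hyh hpsi hnd hatE hE cJ JJ Je ee (fun=> nz _) (fun=> nz _).
  have E (F : M -> 'rV[R]_n.+2) : (fun p => proj_pt (model_point J e0 (F p))) =
      (fun p => proj_pt ((F p, 1) : 'rV[R]_n.+2 * R^o)).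
    by apply/funext => p; rewrite modelE.
  by rewrite !E.
- pose J : {linear 'rV[R]_n.+2 -> 'rV[R]_n.+2} := idfun.
  have modelE x : model_point J 0 x = x by rewrite /model_point addr0.
  have cJ : continuous J by move=> x A hA; exact: hA.
  have psi0 p : model_point J 0 (psi p) <> 0 by rewrite modelE; case: hpsi => _ _ /(_ c0).
  have psih0 p : model_point J 0 (psih p) <> 0.
    by rewrite modelE; exact: (hat_neq0 hB eps2 hyh hpsi hnd hatE).
  have ee : @conf_form R n r 0 0 = - c by rewrite c0 oppr0; exact: (ip0r hB 0).
  have := model_darboux hB eps2 hyh hpsi hnd hatE hB cJ (fun _ _ => erefl) (fun x => ip0r hB x) ee
    psi0 psih0.
  have E (F : M -> 'rV[R]_n.+2) :
      (fun p => proj_pt (model_point J 0 (F p))) = (fun p => proj_pt (F p)).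
    by apply/funext => p; rewrite modelE.
  by rewrite !E.
Qed.
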